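(* Let $(\mathfrak G_n)_n$, $\mathfrak G_n=(N_n,V_n)$, be graphs with exponential (shell) growth with constant $c$. Then, for any $n\in\mathbb N$, any $a,b\ge1$, any $p\in[1,\infty]$ and any $r_n\in\mathbb N$, there exists a partition $\mathcal P_{M_n}=\{B_1,\dots,B_{M_n}\}$ of $N_n$ satisfying $\max_{m\in[M_n]}|B_m|\lesssim q_n$ with $q_n\asymp1$ such that $$\Big\|\sup_{f\in\mathcal F}\mathbb G_n(f)\Big\|_{L^1(\mathbb P)}\lesssim e^{cr_n/2}\,\gamma_{2,a}\Big(\mathcal F,\max_{i\in N_n}\|\cdot\|_{L^{2p}(P_{Z_i})}\Big)+\Big(\frac{e^{cr_n}}{\sqrt n}+\sqrt n\,\bar\tau_{\operatorname{cone}\mathcal F}(r_n)\Big)\gamma_{1,b}(\mathcal F,\|\cdot\|_\infty),$$ where $\bar\tau_{\operatorname{cone}\mathcal F}(r_n):=\bar\tau_{\operatorname{cone}\mathcal F}\big(\mathcal P_{M_n},\mathcal C_{r_n}[\mathcal P_{M_n}]\big)$. Here $\lesssim$ and $\asymp$ hide constants depending only on the growth constants $C,c$ (in particular not on $n,r_n$).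
   Context: Setup. For each $n$, $\mathfrak G_n=(N_n,V_n)$ is a finite graph with $|N_n|=n$; $d_n(i,j)$ is the shortest-path distance ($+\infty$ if no path exists, $d_n(i,i)=0$), $d_n(A,B)=\inf_{i\in A,j\in B}d_n(i,j)$. $(Z_i)_{i\in N_n}$ are random elements with values in a Polish space $(\mathsf Z,\mathcal Z)$ (probability $\mathbb P$, expectation $\mathbb E$; $P_{Z_i}$ is the law of $Z_i$). For disjoint $A,B\subseteq N_n$ with $d_n(A,B)=+\infty$, $\sigma(Z_i:i\in A)$ and $\sigma(Z_j:j\in B)$ are independent. $\mathcal F\ni0$ is a class of real-valued measurable functions on $\mathsf Z$, and $\mathbb G_n(f)=n^{-1/2}\sum_{i\in N_n}\{f(Z_i)-\mathbb E[f(Z_i)]\}$. $[M]=\{1,\dots,M\}$; $Z_B=(Z_i)_{i\in B}$; $\operatorname{cone}\mathcal F=\{\lambda f:f\in\mathcal F,\lambda>0,\|\lambda f\|_\infty\le1\}$. Geometry. With $\partial B(i,s)=\{j\in N_n:d_n(i,j)=s\}$, the graphs have exponential (shell) growth with constant $c$ if there exist $C,c>0$ independent of $n$ such that $\sup_{i\in N_n}|\partial B(i,s)|\le Ce^{cs}$ for all $s\ge1$. Colorings. For a partition $\mathcal P_M=\{B_1,\dots,B_M\}$ of $N_n$, a proper $r$-coloring is a map $\kappa:[M]\to\mathbb N$ such that $\kappa(m)=\kappa(m')$, $m\ne m'$ imply $d_n(B_m,B_{m'})>r$. $K_r=K_r(\mathcal P_M)$ is the smallest possible number of distinct colors over all proper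 $r$-colorings; $\mathcal C_r[\mathcal P_M]$ denotes the collection of color classes $C_k=\kappa^{-1}(k)$, $k\in[K_r]$, of an (arbitrary, fixed) proper $r$-coloring with colors $[K_r]$. $\tau$-coefficient. For a Polish space $\mathsf X$ with pseudometric $d_{\mathsf X}$, an $\mathsf X$-valued $X$ with $\mathbb E[d_{\mathsf X}(X,x_0)]<\infty$ for some $x_0$, and a sub-$\sigma$-field $\mathcal M$, $\tau_{d_{\mathsf X}}(\mathcal M,X):=\big\|\sup_g|\mathbb E[g(X)\mid\mathcal M]-\mathbb E[g(X)]|\big\|_{L^1(\mathbb P)}$, supremum over measurable $g:\mathsf X\to\mathbb R$ that are $1$-Lipschitz for $d_{\mathsf X}$. For $\mathcal B\subseteq\operatorname{span}\mathcal F$ and $z,z'\in\mathsf Z^m$ let $d_{\mathcal B,m}(z,z')=\sum_{s=1}^m\sup_{f\in\mathcal B}|f(z_s)-f(z_s')|$, and $$\bar\tau_{\mathcal B}(\mathcal P_M,\mathcal C_r[\mathcal P_M]):=\frac1n\sum_{k=1}^{K_r}\sum_{m\in C_k}\tau_{d_{\mathcal B,|B_m|}}\Big(\sigma\big(Z_j:j\in\textstyle\bigcup_{m'\in C_k,m'<m}B_{m'}\big),Z_{B_m}\Big),$$ with the trivial $\sigma$-field when the union is empty. Talagrand complexity. For $s>0$, an admissible partition sequence of order $s$ for $\mathcal F$ is a sequence $T^\infty=(T_l)_{l\ge0}$ of partitions of $\mathcal F$ that is increasing (each $T_{l+1}$ refines $T_l$) with $\operatorname{card}(T_0)=1$ and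 $\operatorname{card}(T_l)\le2^{2^{l/s}}$ for $l\ge1$. $T(f,T_l)$ is the element of $T_l$ containing $f$ and $D(f,T_l)(z)=\sup_{f_1,f_2\in T(f,T_l)}|f_1(z)-f_2(z)|$. For a seminorm-type functional $\mathbf d$, $\gamma_{q,s}(\mathcal F,\mathbf d)=\inf_{T^\infty}\sup_{f\in\mathcal F}\sum_{l=0}^\infty2^{l/q}\mathbf d(D(f,T_l))$, the infimum being over admissible partition sequences of order $s$. *)

(* Defs.v *)
From HB Require Import structures.
From mathcomp Require Import all_boot all_order all_algebra.
From mathcomp Require Import all_classical all_reals all_analysis.
From mathcomp Require Import measurable_realfun ess_sup_inf ring.

Set Implicit Arguments.
Unset Strict Implicit.
Unset Printing Implicit Defensive.

Import Order.TTheory GRing.Theory Num.Theory.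
Import numFieldNormedType.Exports.

Local Open Scope classical_set_scope.
Local Open Scope ring_scope.

(* A finite graph is given by a symmetric relation [e : rel N]; loops are
   harmless, as they do not change distances. The infimum of the empty set is
   [+oo], so the distance is infinite when no path joins [i] to [j]. *)
Definition gdist (R : realType) (N : finType) (e : rel N) (i j : N) : \bar R :=
  ereal_inf [set (size p)%:R%:E | p in [set p | path e i p /\ last i p = j]].

Definition gdist_set (R : realType) (N : finType) (e : rel N) (A B : {set N})
    : \bar R :=
  ereal_inf [set gdist R e ij.1 ij.2 | ij in [set ij | ij.1 \in A /\ ij.2 \in B]].

Definition shell (R : realType) (N : finType) (e : rel N) (i : N) (s : nat)
    : {set N} :=
  [set j : N | gdist R e i j == s%:R%:E]%SET.

Definition exp_shell_growth (R : realType) (C c : R) (N : nat -> finType)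
    (e : forall n, rel (N n)) : Prop :=
  forall n (i : N n) (s : nat), (1 <= s)%N ->
    (#|shell R (e n) i s|)%:R <= C * expR (c * s%:R).

Definition partition_family (N : finType) (M : nat) (B : 'I_M -> {set N})
    : Prop :=
  injective B /\ finset.partition [set B m | m : 'I_M]%SET [set: N]%SET.

Definition proper_coloring (R : realType) (N : finType) (e : rel N) (r M : nat)
    (B : 'I_M -> {set N}) (kappa : 'I_M -> nat) : Prop :=
  forall m m', kappa m = kappa m' -> m != m' ->
    (r%:R%:E < gdist_set R e (B m) (B m'))%E.

Definition ncolors (M : nat) (kappa : 'I_M -> nat) : nat :=
  size (undup (codom kappa)).

Lemma chromatic_ex (R : realType) (N : finType) (e : rel N) (r M : nat)
    (B : 'I_M -> {set N}) :
  exists k, `[< exists2 kappa, proper_coloring R e r B kappa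
                             & ncolors kappa = k >].
Proof.
exists (ncolors (@nat_of_ord M)); apply/asboolP.
exists (@nat_of_ord M) => // m m' /ord_inj ->; by rewrite eqxx.
Qed.

Definition chromatic (R : realType) (N : finType) (e : rel N) (r M : nat)
    (B : 'I_M -> {set N}) : nat :=
  ex_minn (chromatic_ex R e r B).

Definition polish_space (R : realType) (S : topologicalType) : Prop :=
  (exists2 D : set S, countable D & dense D) /\
  exists dist : S -> S -> R,
    [/\ (forall x y, dist x y = 0 <-> x = y),
        (forall x y, dist x y = dist y x),
        (forall x y z, dist x z <= dist x y + dist y z),
        (forall x (A : set S), nbhs x A <->
           exists2 eps : R, 0 < eps & [set y | dist x y < eps] `<=` A) &
        (forall u : nat -> S,
           (forall eps : R, 0 < eps -> exists k0, forall k l, (k0 <= k)%N ->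
              (k0 <= l)%N -> dist (u k) (u l) < eps) ->
           exists l : S, u @ \oo --> l)].

Notation borel S := (g_sigma_algebraType (@open S)).

(* The sigma-field generated by [Z i], [i \in A]; trivial if [A] is empty. *)
Definition sigma_gen dO dZ (Omega : measurableType dO) (Zs : measurableType dZ)
    (N : finType) (Z : N -> Omega -> Zs) (A : {set N}) : set (set Omega) :=
  <<s [set E | exists2 i, i \in A &
                 exists2 U, measurable U & E = Z i @^-1` U] >>.

Definition independent_fields dO (Omega : measurableType dO) (R : realType)
    (P : probability Omega R) (M1 M2 : set (set Omega)) : Prop :=
  forall E1 E2, M1 E1 -> M2 E2 -> P (E1 `&` E2) = (P E1 * P E2)%E.

Definition ae_upper_bound dO (Omega : measurableType dO) (R : realType)
    (P : probability Omega R) (Y : set (Omega -> \bar R)) (U : Omega -> \bar R)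
    : Prop :=
  measurable_fun [set: Omega] U /\ forall f, Y f -> {ae P, forall w, (f w <= U w)%E}.

Definition is_ess_supremum dO (Omega : measurableType dO) (R : realType)
    (P : probability Omega R) (Y : set (Omega -> \bar R)) (U : Omega -> \bar R)
    : Prop :=
  ae_upper_bound P Y U /\
  forall V, ae_upper_bound P Y V -> {ae P, forall w, (U w <= V w)%E}.

(* A least upper bound of [Y] up to null sets, unique up to null sets; it always
   exists (ess_supremumP), so the default value of [xget] is never used. *)
Definition ess_supremum dO (Omega : measurableType dO) (R : realType)
    (P : probability Omega R) (Y : set (Omega -> \bar R)) : Omega -> \bar R :=
  xget (cst -oo%E) [set U | is_ess_supremum P Y U].

Lemma measurable_contract dO (Omega : measurableType dO) (R : realType)
    (V : Omega -> \bar R) :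
  measurable_fun [set: Omega] V -> measurable_fun setT (fun w => contract (V w)).
Proof.
move=> mV; apply: (measurability (@RGenOInfty.G R)).
  exact: RGenOInfty.measurableE.
move=> _ [_ [x ->] <-]; rewrite setTI.
have [x1|x1] := leP `|x| 1.
  rewrite (_ : _ @^-1` _ = V @^-1` `]expand x, +oo[).
    by rewrite -[_ @^-1` _]setTI; apply: mV => //; exact: emeasurable_itv.
  by apply/seteqP; split=> w /=; rewrite !in_itv/= !andbT -(lt_contract (expand x)) expandK.
have [x0|x0] := leP 0 x.
  rewrite (_ : _ @^-1` _ = set0)//; apply/seteqP; split=> w //=.
  rewrite in_itv/= andbT; move: x1; rewrite ger0_norm// => x1 xV.
  have := contract_le1 (V w); rewrite leNgt (lt_le_trans _ (ler_norm _))//.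
  exact: lt_trans xV.
rewrite (_ : _ @^-1` _ = setT)//; apply/seteqP; split=> w //= _.
rewrite in_itv/= andbT; move: x1; rewrite ltr0_norm// ltrNr => /lt_le_trans; apply.
by have := contract_le1 (V w); rewrite ler_norml => /andP[].
Qed.

Lemma ess_supremumP dO (Omega : measurableType dO) (R : realType)
    (P : probability Omega R) (Y : set (Omega -> \bar R)) :
  is_ess_supremum P Y (ess_supremum P Y).
Proof.
pose ub := [set V | ae_upper_bound P Y V].
pose phi V := (\int[P]_w (1 + contract (V w))%:E)%E.
have phi0 (V : Omega -> \bar R) w : (0 <= (1 + contract (V w))%:E)%E.
  have := contract_le1 (V w); rewrite ler_norml => /andP[V1 _].
  by rewrite lee_fin -lerBlDl sub0r.
have mphi V : ub V -> measurable_fun [set: Omega] (fun w => (1 + contract (V w))%:E).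
  move=> [mV _]; apply/measurable_EFinP; apply: measurable_funD => //.
  exact: measurable_contract.
have phile V : ub V -> (phi V <= 2%:E)%E.
  move=> uV; apply: (@le_trans _ _ (\int[P]_w (cst 2%:E w))%E).
    apply: ge0_le_integral => //; first exact: mphi.
    move=> w _; rewrite lee_fin -natr1 lerD//.
    by have := contract_le1 (V w); rewrite ler_norml => /andP[].
  rewrite integral_cst//.
  by rewrite -[leRHS]mule1 lee_wpmul2l//; exact: probability_le1.
pose I := ereal_inf (phi @` ub).
have uboo : ub (cst +oo%E).
  by split=> // f Yf; apply: nearW => w; rewrite leey.
have Ifin : I \is a fin_num.
  rewrite ge0_fin_numE.
    apply: le_lt_trans (ltry 2); apply: le_trans (phile _ uboo).
    by apply: ereal_inf_lbound; exists (cst +oo%E).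
  by apply: le_ereal_inf_tmp => _ [V _ <-]; exact: integral_ge0.
have : forall k : nat, exists V, ub V /\ (phi V < I + (k.+1%:R^-1)%:E)%E.
  move=> k; have /ereal_inf_lt[_ [V uV <-] lV] :
      (ereal_inf (phi @` ub) < I + (k.+1%:R^-1)%:E)%E.
    by rewrite lteDl// lte_fin.
  by exists V.
move=> /choice[V_ HV].
pose U w := ereal_inf [set V_ k w | k in setT].
have mU : measurable_fun [set: Omega] U.
  rewrite (_ : U = fun w => einfs (V_ ^~ w) 0%N).
    by apply: measurable_fun_einfs => k; case: (HV k) => -[].
  apply/funext => w; rewrite /U /einfs/=; congr ereal_inf; apply/seteqP.
  by split=> y [k _ <-]; exists k.
have ubU : ub U.
  split=> // f Yf.
  have : {ae P, forall w, forall k, (f w <= V_ k w)%E}.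
    by apply: ae_foralln => k; case: (HV k) => -[_ h] _; exact: h.
  apply: filterS => w fV; apply: le_ereal_inf_tmp => _ [k _ <-]; exact: fV.
have mono V V' : ub V -> ub V' -> (forall w, (V w <= V' w)%E) -> (phi V <= phi V')%E.
  move=> uV uV' VV'; apply: ge0_le_integral => //; [exact: mphi|exact: mphi|].
  by move=> w _; rewrite lee_fin lerD2l le_contract.
have phiU : phi U = I.
  apply/eqP; rewrite eq_le; apply/andP; split; last first.
    by apply: ereal_inf_lbound; exists U.
  apply/lee_addgt0Pr => e e0; have [k ke] := ltr_add_invr e0; rewrite add0r in ke.
  case: (HV k) => uV /ltW lV; apply: le_trans (le_trans lV _).
    by apply: mono => // w; apply: ereal_inf_lbound; exists k.
  by rewrite leeD2l// lee_fin ltW.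
suff : is_ess_supremum P Y U.
  by move=> h; apply: (@xgetPex _ _ [set U | is_ess_supremum P Y U]); exists U.
split=> // V uV.
pose W w := mine (U w) (V w).
have ubW : ub W.
  split; first by apply: measurable_mine => //; case: uV.
  move=> f Yf; case: ubU => _ /(_ _ Yf) h1; case: uV => _ /(_ _ Yf) h2.
  by apply: filterS2 h1 h2 => w fU fV; rewrite le_min fU.
have phiW : phi W = I.
  apply/eqP; rewrite eq_le; apply/andP; split; last first.
    by apply: ereal_inf_lbound; exists W.
  by rewrite -phiU; apply: mono => // w; rewrite ge_min lexx.
pose D w := (contract (U w) - contract (W w))%:E.
have D0 w : (0 <= D w)%E.
  by rewrite lee_fin subr_ge0 le_contract ge_min lexx.
have mD : measurable_fun [set: Omega] D.
  apply/measurable_EFinP/measurable_funB; apply: measurable_contract => //.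
  by case: ubW.
have : (phi W + \int[P]_w D w = phi W)%E.
  rewrite -ge0_integralD//; last exact: mphi.
  rewrite phiW -phiU; apply: eq_integral => w _.
  by rewrite -EFinD addrACA subrr; congr (_ %:E); ring.
rewrite phiW addeC => DI.
have iD : (\int[P]_w D w = 0)%E.
  by rewrite -[LHS](addeK _ Ifin) DI subee.
have : ae_eq P setT D (cst 0%E).
  apply/(ae_eq_integral_abs P measurableT mD).
  by under eq_integral => w _ do rewrite gee0_abs//.
apply: filterS => w /(_ Logic.I)/= [] /eqP; rewrite subr_eq0 => /eqP/contract_inj UW.
by rewrite UW /W ge_min lexx orbT.
Qed.

Definition is_cond_expectation dO (Omega : measurableType dO) (R : realType)
    (P : probability Omega R) (F : set (set Omega)) (X Y : Omega -> R) : Prop :=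
  [/\ forall U : set R, measurable U -> F (Y @^-1` U),
      P.-integrable setT (EFin \o Y) &
      forall A, F A ->
        (\int[P]_(w in A) (Y w)%:E = \int[P]_(w in A) (X w)%:E)%E].

Definition lipschitz1 (R : realType) (X : Type) (d : X -> X -> \bar R)
    (g : X -> R) : Prop :=
  forall x y, (`|g x - g y|%:E <= d x y)%E.

(* A conditional expectation is an almost sure class, so the supremum over the
   (uncountable) class of Lipschitz functions is the essential one. The distance
   may be [+oo], as it can be for [dist_class] below. *)
Definition tau dO (Omega : measurableType dO) (R : realType)
    (P : probability Omega R) (F : set (set Omega)) dX (X : measurableType dX)
    (d : X -> X -> \bar R) (xi : Omega -> X) : \bar R :=
  ('N[P]_1%:E[ess_supremum P
     [set h | exists g : X -> R, exists Y : Omega -> R,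
        [/\ measurable_fun [set: X] g, lipschitz1 d g,
            is_cond_expectation P F (g \o xi) Y &
            h = fun w => `|Y w - fine 'E_P[g \o xi]|%:E]]])%E.

Definition sup_norm (R : realType) (T : Type) (h : T -> \bar R) : \bar R :=
  ereal_sup [set `|h z|%E | z in setT].

Definition cone (R : realType) (T : Type) (F : set (T -> R)) : set (T -> R) :=
  [set h | exists f lambda, [/\ F f, 0 < lambda, h = (fun z => lambda * f z) &
                                (sup_norm (EFin \o h) <= 1%:E)%E]].

Definition dist_class (R : realType) (T : Type) (F : set (T -> R)) (m : nat)
    (z z' : m.-tuple T) : \bar R :=
  (\sum_(s < m)
     ereal_sup [set `|f (tnth z s) - f (tnth z' s)|%:E | f in F])%E.

Definition block (Omega Zs : Type) (N : finType) (Z : N -> Omega -> Zs)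
    (B : {set N}) (w : Omega) : #|B|.-tuple Zs :=
  [tuple Z (enum_val s) w | s < #|B|].

Definition tau_bar dO (Omega : measurableType dO) (R : realType)
    (P : probability Omega R) dZ (Zs : measurableType dZ)
    (N : finType) (Z : N -> Omega -> Zs) (F : set (Zs -> R))
    (M : nat) (B : 'I_M -> {set N}) (K : nat) (kappa : 'I_M -> 'I_K) : \bar R :=
  ((#|N|%:R^-1)%:E *
   \sum_(k < K) \sum_(m < M | kappa m == k)
     tau P (sigma_gen Z (\bigcup_(m' < M | (kappa m' == k) && (m' < m)%N) B m')%SET)
         (@dist_class R Zs F #|B m|) (block Z (B m)))%E.

Definition admissible (R : realType) (s : R) (T : Type) (F : set (T -> R))
    (Pi : nat -> set (set (T -> R))) : Prop :=
  [/\ forall l, partition (Pi l) id F,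
      forall l A, Pi l.+1 A -> exists2 A', Pi l A' & A `<=` A',
      (Pi 0%N #= `I_1)%card &
      forall l, (1 <= l)%N -> exists2 k, (Pi l #= `I_k)%card &
        k%:R <= 2 `^ (2 `^ (l%:R / s))].

Definition cell (R : realType) (T : Type) (Pi : set (set (T -> R)))
    (f : T -> R) : set (T -> R) :=
  [set g | exists A, [/\ Pi A, A f & A g]].

(* [diam] need not be measurable for an arbitrary [F] of measurable functions, but
   it is as soon as [gamma q s F sup_norm] is finite: [F] is then totally bounded for the
   supremum norm and the suprema can be taken over countable subsets. *)
Definition diam (R : realType) (T : Type) (Pi : set (set (T -> R)))
    (f : T -> R) (z : T) : \bar R :=
  ereal_sup [set `|ff.1 z - ff.2 z|%:E
            | ff in [set ff | cell Pi f ff.1 /\ cell Pi f ff.2]].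

Definition gamma (R : realType) (q s : R) (T : Type) (F : set (T -> R))
    (d : (T -> \bar R) -> \bar R) : \bar R :=
  ereal_inf
    [set ereal_sup
       [set (\sum_(0 <= l <oo) (2 `^ (l%:R / q))%:E * d (diam (Pi l) f))%E
       | f in F]
    | Pi in [set Pi | admissible s F Pi]].

Definition empirical dO (Omega : measurableType dO) (R : realType)
    (P : probability Omega R) (T : Type) (N : finType) (Z : N -> Omega -> T)
    (f : T -> R) (w : Omega) : R :=
  (Num.sqrt #|N|%:R)^-1 * \sum_(i : N) (f (Z i w) - fine 'E_P[f \o Z i]).

Definition max_Lnorm dO (Omega : measurableType dO) (R : realType)
    (P : probability Omega R) dZ (Zs : measurableType dZ)
    (N : finType) (Z : N -> {RV P >-> Zs}) (p : \bar R) (h : Zs -> \bar R)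
    : \bar R :=
  \big[maxe/0%E]_(i : N) ('N[distribution P (Z i)]_p[h])%E.

(* Main.v *)
(* The blocks are singletons. Balls of radius r have at most a constant times
   e^{cr} vertices, so a greedy colouring shows that K_r is of that order.

   Let (g_i) be a finite net of F. Within one colour class, the variables Z_m are made
   independent without any coupling, by a Lindeberg replacement starting from the
   last index: for a 2-Lipschitz function Psi of the vector of centred partial sums,
   the function z |-> Psi(past + g(z)) is, up to the factor 2 sup |F|, 1-Lipschitz for
   the distance given by cone F, so averaging it over Z_m independently of the past
   costs at most 2 sup |F| tau (the past being discretized, only finitely many test
   functions occur), and the averaged function is again 2-Lipschitz. Applied to
   Psi(u) = max_i (u_i - u_{i0})^+ this leaves an iterated average, which is
   bounded by generic chaining along the common refinement of the two partition
   sequences: on each link one uses x <= t (s + exp (x / t - s)) with a scale t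
   adapted to the link, and Bernstein's bound on exponential moments. This gives
   O(sqrt |C_k| gamma_2 + gamma_1) for the colour class C_k, and
   sum_k sqrt |C_k| <= sqrt (K_r n). *)
Require Import Defs.
From HB Require Import structures.
From mathcomp Require Import all_boot all_order all_algebra.
From mathcomp Require Import all_classical all_reals all_analysis.
From mathcomp Require Import measurable_realfun ess_sup_inf.
From mathcomp Require Import ring lra.

Set Implicit Arguments.
Unset Strict Implicit.
Unset Printing Implicit Defensive.

Import Order.TTheory GRing.Theory Num.Theory.
Import numFieldNormedType.Exports.

Local Open Scope classical_set_scope.
Local Open Scope ring_scope.

(** * Colourings *)

Section graph_distance.
Context (R : realType) (N : finType) (e : rel N).

(** Path lengths are natural numbers, so the infimum is attained as soon as it is finite. *)
Lemma gdist_natP (i j : N) (r : nat) : (gdist R e i j <= r%:R%:E)%E ->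
  exists2 p, path e i p /\ last i p = j &
    gdist R e i j = (size p)%:R%:E /\ (size p <= r)%N.
Proof.
move=> dr.
have [p0 [p0e p0j]] : exists p, path e i p /\ last i p = j.
  apply: contrapT => h; suff dy : gdist R e i j = +oo%E by rewrite dy in dr.
  rewrite /gdist (_ : [set _ | _ in _] = set0) ?ereal_inf0//.
  by apply/seteqP; split=> // x [p pP _]; apply: h; exists p.
pose Q k := `[< exists2 p, path e i p /\ last i p = j & size p = k >].
have exQ : exists k, Q k by exists (size p0); apply/asboolP; exists p0.
case: (ex_minnP exQ) => k /asboolP[p pP pk] kmin.
have dk : gdist R e i j = (size p)%:R%:E.
  apply/eqP; rewrite eq_le; apply/andP; split.
    by apply: ereal_inf_lbound; exists p.
  apply: le_ereal_inf_tmp => _ [p1 p1P <-].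
  by rewrite lee_fin ler_nat pk kmin//; apply/asboolP; exists p1.
by exists p => //; split=> //; rewrite dk lee_fin ler_nat in dr.
Qed.

Lemma gdist_le_shell (i j : N) (r : nat) : (gdist R e i j <= r%:R%:E)%E ->
  j != i -> exists2 s, (1 <= s <= r)%N & j \in shell R e i s.
Proof.
move=> /gdist_natP[p [_ pj] [dE pr]] ji; exists (size p); last by rewrite inE dE.
rewrite pr andbT lt0n size_eq0; apply: contraNneq ji => p0.
by rewrite -pj p0.
Qed.

Lemma gdist_sym (i j : N) : symmetric e -> gdist R e i j = gdist R e j i.
Proof.
move=> se; suff le x y : (gdist R e x y <= gdist R e y x)%E.
  by apply/eqP; rewrite eq_le !le.
apply: le_ereal_inf_tmp => _ [p [pe px] <-]; apply: ereal_inf_lbound.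
exists (rev (belast y p)); last by rewrite size_rev size_belast.
rewrite -px; split.
  by rewrite rev_path (eq_path (e' := e))// => a b; exact: se.
by case: p {pe px} => //= z p; rewrite rev_cons last_rcons.
Qed.

Lemma gdist_set1 (i j : N) :
  gdist_set R e [set i]%SET [set j]%SET = gdist R e i j.
Proof.
rewrite /gdist_set (_ : [set _ | _ in _] = [set gdist R e i j]) ?ereal_inf1//.
apply/seteqP; split=> [_ [[a b] /= [/set1P-> /set1P->] <-]//|_ ->].
by exists (i, j) => //=; rewrite !inE.
Qed.

End graph_distance.

(** Induction on the number of coloured vertices: the neighbours of the next vertex occupy at most
    [D] of the [D.+1] colours, so one is left for it. *)
Lemma greedy_coloring (M D : nat) (adj : rel 'I_M) :
  symmetric adj -> irreflexive adj ->
  (forall i, #|[set j | adj i j]%SET| <= D)%N ->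
  exists kappa : 'I_M -> 'I_D.+1, forall i j, adj i j -> kappa i != kappa j.
Proof.
move=> sadj iadj dD.
suff H k : (k <= M)%N -> exists kappa : 'I_M -> 'I_D.+1,
    forall i j : 'I_M, (i < k)%N -> (j < k)%N -> adj i j -> kappa i != kappa j.
  by have [kappa P] := H M (leqnn M); exists kappa => i j; apply: P.
elim: k => [|k IH] kM; first by exists (fun=> ord0).
have [kappa P] := IH (ltnW kM).
pose v := Ordinal kM.
have [c cP] : exists c, c \notin [set kappa j | j in [set j | adj v j]]%SET.
  apply/existsP; rewrite -negb_forall; apply/negP => /forallP h.
  have := leq_imset_card kappa [set j | adj v j]%SET.
  rewrite (_ : [set kappa j | j in _]%SET = [set: 'I_D.+1]%SET); last first.
    by apply/setP => c; rewrite h inE.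
  by rewrite cardsT card_ord leqNgt ltnS dD.
exists (fun j => if j == v then c else kappa j) => i j ik jk aij.
have neq (x : 'I_M) : (x < k.+1)%N -> x != v -> (x < k)%N.
  by rewrite ltnS leq_eqVlt => /orP[/eqP xk|//] /negP[]; apply/eqP/val_inj.
have [iv|iv] := eqVneq i v; have [jv|jv] := eqVneq j v.
- by rewrite iv jv iadj in aij.
- apply: contra cP => /eqP->; apply/imsetP; exists j => //; by rewrite inE -iv.
- rewrite eq_sym; apply: contra cP => /eqP->; apply/imsetP; exists i => //.
  by rewrite inE -jv sadj.
- by apply: P => //; exact: neq.
Qed.

Definition singletons (N : finType) (m : 'I_#|N|) : {set N} :=
  [set enum_val m]%SET.

Lemma singletons_partition (N : finType) :
  partition_family (@singletons N).
Proof.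
split; first by move=> i j /set1_inj/enum_val_inj.
apply/and3P; split.
- rewrite /finset.cover; apply/eqP/setP => x; rewrite inE; apply/bigcupP.
  exists (singletons (enum_rank x)); first by apply/imsetP; exists (enum_rank x).
  by rewrite /singletons enum_rankK inE.
- apply/finset.trivIsetP => _ _ /imsetP[i _ ->] /imsetP[j _ ->] ij.
  rewrite -setI_eq0; apply/eqP/setP => x; rewrite !inE.
  by apply: contraNF ij => /andP[/eqP-> /eqP/enum_val_inj->].
- by apply/imsetP => -[i _ /esym/eqP]; rewrite /singletons -cards_eq0 cards1.
Qed.

(** The induction closes because [A = (1 - expR (- c))^-1] satisfies [A * expR (- c) + 1 = A]: the
    sum has the order of its last term. *)
Lemma sum_expR_le (R : realType) (c : R) (r : nat) : 0 < c ->
  \sum_(1 <= s < r.+1) expR (c * s%:R) <= (1 - expR (- c))^-1 * expR (c * r%:R).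
Proof.
move=> c0; have e1 : 0 < 1 - expR (- c) by rewrite subr_gt0 expR_lt1 oppr_lt0.
elim: r => [|r IH].
  by rewrite big_geq// mulr_ge0 ?expR_ge0// invr_ge0 ltW.
rewrite big_nat_recr//=; apply: le_trans (lerD IH (lexx _)) _.
have -> : expR (c * r%:R) = expR (- c) * expR (c * r.+1%:R).
  by rewrite -expRD -natr1; congr expR; ring.
rewrite mulrA -[X in _ + X]mul1r -mulrDl ler_wpM2r ?expR_ge0//.
by rewrite -[X in _ + X](mulVf (lt0r_neq0 e1)) -mulrDr [X in _ * X]addrC subrK mulr1.
Qed.

(** Adding the shells of radius 1 to [r] bounds the degree of the graph of pairs at distance at most
    [r]. The one extra colour of the greedy bound is absorbed by [expR (c * r%:R) >= 1]. *)
Lemma chromatic_singletons (R : realType) (C c : R) (N : finType) (e : rel N)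
    (r : nat) : 0 < C -> 0 < c -> symmetric e ->
  (forall (i : N) (s : nat), (1 <= s)%N ->
    (#|shell R e i s|)%:R <= C * expR (c * s%:R)) ->
  (chromatic R e r (@singletons N))%:R
    <= (1 + C * (1 - expR (- c))^-1) * expR (c * r%:R).
Proof.
move=> C0 c0 se growth.
have e1 : 0 < 1 - expR (- c) by rewrite subr_gt0 expR_lt1 oppr_lt0.
set A := C * _.
have A0 : 0 <= A by rewrite mulr_ge0 ?ltW// invr_gt0.
pose D := Num.truncn (A * expR (c * r%:R)).
have Ar0 : 0 <= A * expR (c * r%:R) by rewrite mulr_ge0 ?expR_ge0.
pose adj (i j : 'I_#|N|) :=
  (j != i) && (gdist R e (enum_val i) (enum_val j) <= r%:R%:E)%E.
have [||i|kappa kP] := @greedy_coloring #|N| D adj.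
- by move=> i j; rewrite /adj eq_sym gdist_sym.
- by move=> i; rewrite /adj eqxx.
- rewrite /D -(ler_nat R); apply: (@le_trans _ _ (Num.truncn (A * expR (c * r%:R)))%:R).
    2: by [].
  rewrite ler_nat truncn_ge_nat//.
  have sub : [set enum_val j | j in [set j | adj i j]%SET]%SET \subset
      \bigcup_(1 <= s < r.+1) shell R e (enum_val i) s.
    apply/fintype.subsetP => _ /imsetP[j + ->]; rewrite inE => /andP[ji].
    move=> /gdist_le_shell[|s sr js]; first by rewrite (inj_eq enum_val_inj).
    by rewrite (bigD1_seq s) ?iota_uniq ?mem_index_iota//= inE js.
  have := subset_leq_card sub.
  rewrite card_imset; last exact: enum_val_inj.
  move=> /leq_trans /(_ (_ : _ <= \sum_(1 <= s < r.+1) #|shell R e (enum_val i) s|)%N) h.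
  have {}h : (#|[set j | adj i j]%SET| <= \sum_(1 <= s < r.+1) #|shell R e (enum_val i) s|)%N.
    apply: h; elim/big_ind2 : _ => [|x a y b xa yb|//]; first by rewrite cards0.
    by rewrite (leq_trans (leq_card_setU _ _).1)// leq_add.
  rewrite -(ler_nat R) in h; apply: le_trans h _.
  rewrite natr_sum; apply: le_trans (_ : C * \sum_(1 <= s < r.+1) expR (c * s%:R) <= _).
    rewrite mulr_sumr !big_nat; apply: ler_sum => s /andP[s1 _]; exact: growth.
  by rewrite /A -[leRHS]mulrA; apply: ler_wpM2l; [exact: ltW|exact: sum_expR_le].
rewrite /chromatic; case: ex_minnP => K _ /(_ (ncolors (fun m => kappa m : nat))) Kmin.
apply: (@le_trans _ _ (D.+1)%:R).
  rewrite ler_nat (leq_trans (Kmin _))//.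
    apply/asboolP; exists (fun m => kappa m : nat) => // m m' /val_inj mm' neq.
    rewrite gdist_set1 ltNge; apply/negP => dle.
    have : adj m m' by rewrite /adj eq_sym neq.
    by move=> /kP; rewrite mm' eqxx.
  rewrite /ncolors -[leqRHS](size_iota 0) uniq_leq_size ?undup_uniq// => x.
  by rewrite mem_undup => /codomP[m ->]; rewrite mem_iota/=.
rewrite -natr1 addrC mulrDl mul1r lerD//.
  by rewrite -[leLHS]expR0 ler_expR mulr_ge0// ltW.
by rewrite truncn_le.
Qed.
(** * Decoupling *)

(** Push [P] and the charge with density [f] forward along the identity onto [Omega] with the
    smaller sigma-algebra; a Radon-Nikodym density there is measurable for that sigma-algebra by
    construction. *)
Lemma cond_expectation_ex dO (Omega : measurableType dO) (R : realType)
    (P : probability Omega R) (G0 : set (set Omega)) (f : Omega -> R) :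
  G0 `<=` measurable -> P.-integrable setT (EFin \o f) ->
  exists Y, is_cond_expectation P <<s G0>> f Y.
Proof.
move=> mG intf.
pose T' := g_sigma_algebraType G0.
have mS (A : set T') : measurable A -> dO.-measurable (A : set Omega).
  by apply: (smallest_sub _ mG); exact: sigma_algebra_measurable.
have mid : measurable_fun [set: Omega] (id : Omega -> T').
  by move=> _ A mA; rewrite setTI preimage_id; exact: mS.
pose idm : {mfun Omega >-> T'} := mfun_Sub (mem_set mid).
pose mu : probability T' R := distribution P idm.
pose nu_ : {charge set T' -> \bar R} := pushforward (induced_charge intf) idm.
pose nu := nu_ mid.
have numu : nu `<< mu.
  apply/null_content_dominatesP => A mA PA.
  apply: null_set_integral => //; first exact: mS.
  by apply: measurable_funTS; exact: measurable_int intf.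
have iY := Radon_Nikodym_integrable numu.
pose Y' := Radon_Nikodym nu mu.
have EY' : EFin \o (fine \o Y') = Y'.
  by apply/funext => w /=; rewrite fineK// Radon_Nikodym_fin_num.
have iP : P.-integrable [set: Omega] (Y' : Omega -> \bar R).
  have mY : measurable_fun [set: T'] Y' by exact: measurable_int iY.
  apply/integrableP; split.
    by move=> _ U mU; apply: mS; exact: mY.
  have /integrableP[_] := iY; rewrite ge0_integral_pushforward//=.
  exact: measurableT_comp.
exists (fine \o Y'); split.
- move=> U mU; have := measurable_int _ iY; rewrite -/Y' -EY'.
  move=> /measurable_EFinP /(_ measurableT _ mU); by rewrite setTI.
- rewrite EY'; exact: iP.
- move=> A mA; rewrite -[RHS]/(nu A) (Radon_Nikodym_integral numu)//.
  rewrite integral_pushforward//=; last first.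
    by apply: (integrableS measurableT) iP => //; exact: mS.
  by rewrite preimage_id; apply: eq_integral => w _; rewrite -/Y' -EY'.
Qed.
Lemma integrable_bounded d (T : measurableType d) (R : realType)
    (P : probability T R) (X : T -> R) (b : R) :
  measurable_fun [set: T] X -> (forall w, `|X w| <= b) ->
  P.-integrable [set: T] (fun w => (X w)%:E).
Proof.
move=> mX Xb; apply: (@le_integrable _ _ _ _ _ measurableT _ (cst b%:E)).
- exact/measurable_EFinP.
- by move=> w _ /=; rewrite lee_fin (le_trans (Xb _))// ler_norm.
- exact: finite_measure_integrable_cst.
Qed.

Section potential.
Context (R : realType) (I : Type).

(* Measurability is asked along every measurable family of arguments, which
   avoids putting a sigma-algebra on [I -> R]. *)
Definition potential (k : R) (Psi : (I -> R) -> \bar R) : Prop :=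
  [/\ (forall d (T : measurableType d) (U : T -> I -> R),
         (forall i, measurable_fun [set: T] (U ^~ i)) ->
         measurable_fun [set: T] (fun t => Psi (U t))),
      (forall u, (0 <= Psi u)%E),
      (forall u, (Psi u < +oo)%E) &
      (forall u v (delta : R), 0 <= delta -> (forall i, `|u i - v i| <= delta) ->
         (Psi u <= Psi v + (k * delta)%:E)%E)].

(** One Lindeberg replacement: [V] is integrated out with [u] held fixed, as if it were independent
    of [u]. *)
Definition avg dO (Omega : measurableType dO) (P : probability Omega R)
    (V : Omega -> I -> R) (Psi : (I -> R) -> \bar R) (u : I -> R) : \bar R :=
  (\int[P]_w Psi (fun i => u i + V w i)%R)%E.

Lemma integral_cst1 dO (Omega : measurableType dO) (P : probability Omega R)
    (x : \bar R) : (\int[P]_w x = x)%E.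
Proof.
by have /= -> := @integral_cst _ _ _ P _ measurableT x; rewrite probability_setT mule1.
Qed.

Lemma ge0_integralD_cst dO (Omega : measurableType dO) (P : probability Omega R)
    (f : Omega -> \bar R) (x : \bar R) : measurable_fun [set: Omega] f ->
  (forall w, 0 <= f w)%E -> (0 <= x)%E ->
  (\int[P]_w (f w + x) = \int[P]_w f w + x)%E.
Proof. by move=> mf f0 x0; rewrite ge0_integralD// integral_cst1. Qed.

Section avg.
Context dO (Omega : measurableType dO) (P : probability Omega R).
Context (V : Omega -> I -> R) (beta k : R) (Psi : (I -> R) -> \bar R).
Hypotheses (mV : forall i, measurable_fun [set: Omega] (V ^~ i)).
Hypotheses (Vb : forall w i, `|V w i| <= beta).
Hypotheses (b0 : 0 <= beta) (k0 : 0 <= k) (pPsi : potential k Psi).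

Lemma measurable_shift (u : I -> R) :
  measurable_fun [set: Omega] (fun w => Psi (fun i => u i + V w i)).
Proof. by case: pPsi => + _ _ _; apply => i; exact: measurable_funD. Qed.

(** The constant [k] does not deteriorate under averaging, so replacements can be iterated.
    Finiteness comes from the bound on [V], measurability from Fubini-Tonelli. *)
Lemma avg_potential : potential k (avg P V Psi).
Proof.
have [mPsi Psi0 Psioo lPsi] := pPsi.
split => [d T U mU|u|u|u v delta delta0 uv].
- pose f (tw : T * Omega) := Psi (fun i => U tw.1 i + V tw.2 i).
  apply: (@measurable_fun_fubini_tonelli_F _ _ _ _ _ P f) => [|x]; last exact: Psi0.
  apply: mPsi => i; apply: measurable_funD.
    exact: (measurableT_comp (mU i) measurable_fst).
  exact: (measurableT_comp (mV i) measurable_snd).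
- exact: integral_ge0.
- apply: (@le_lt_trans _ _ (\int[P]_w (Psi u + (k * beta)%:E))%E).
    apply: ge0_le_integral => //; first exact: measurable_shift.
    by move=> w _; apply: lPsi => // i; rewrite addrC addKr.
  by rewrite integral_cst1 lte_add_pinfty// ltry.
- rewrite /avg -ge0_integralD_cst//; last 2 first.
    exact: measurable_shift.
    by rewrite lee_fin mulr_ge0.
  apply: ge0_le_integral => //.
  + exact: measurable_shift.
  + by apply: emeasurable_funD => //; exact: measurable_shift.
  + by move=> w _; apply: lPsi => // i; rewrite opprD addrACA subrr addr0.
Qed.

End avg.
End potential.

Lemma ge0_integral_fibers dO (Omega : measurableType dO) (R : realType)
    (mu : {measure set Omega -> \bar R}) (J : finType) (kappa : Omega -> J)
    (f : Omega -> \bar R) : (forall j, measurable (kappa @^-1` [set j])) ->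
  measurable_fun [set: Omega] f -> (forall w, 0 <= f w)%E ->
  (\int[mu]_w f w = \sum_j \int[mu]_(w in kappa @^-1` [set j]) f w)%E.
Proof.
move=> mk mf f0.
have -> : [set: Omega] = \big[setU/set0]_(j <- index_enum J) (kappa @^-1` [set j]).
  rewrite -bigcup_seq; apply/seteqP; split=> // w _; exists (kappa w) => //=.
  by rewrite mem_index_enum.
rewrite ge0_integral_bigsetU//; first exact: index_enum_uniq.
  by move=> i j _ _ [w [/= -> ->]].
exact: measurable_funTS.
Qed.

(** Each coordinate is rounded down to a grid of mesh [eps] starting at [- rho]. The fibres are
    measurable for the sigma-algebra of [T], which will be that of the past. *)
Lemma discretize d (T : measurableType d) (R : realType) (I : finType)
    (U : T -> I -> R) (rho eps : R) :
  (forall i, measurable_fun [set: T] (U ^~ i)) ->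
  (forall w i, `|U w i| <= rho) -> 0 < eps ->
  exists (J : finType) (kappa : T -> J) (v : J -> I -> R),
    (forall j, measurable (kappa @^-1` [set j])) /\
    (forall w i, `|U w i - v (kappa w) i| <= eps).
Proof.
move=> mU Ub e0.
pose K := Num.truncn ((rho + rho) / eps).
pose q (w : T) (i : I) := Num.truncn ((U w i + rho) / eps).
have q0 w i : 0 <= (U w i + rho) / eps.
  apply: divr_ge0; [rewrite -lerBlDr sub0r|exact: ltW].
  by have := Ub w i; rewrite ler_norml => /andP[].
have qK w i : (q w i < K.+1)%N.
  rewrite ltnS le_truncn// ler_pM2r ?invr_gt0// lerD2r.
  by have := Ub w i; rewrite ler_norml => /andP[].
have qitv w i m : (q w i == m) = (U w i \in `[m%:R * eps - rho, m.+1%:R * eps - rho[).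
  rewrite in_itv/= lerBlDr ltrBrDr -ler_pdivlMr// -ltr_pdivrMr//.
  by rewrite /q truncn_eq.
exists {ffun I -> 'I_K.+1}, (fun w => [ffun i => inord (q w i)]),
  (fun (j : {ffun I -> 'I_K.+1}) i => (j i)%:R * eps - rho); split=> [j|w i].
  rewrite (_ : _ @^-1` _ = \bigcap_(i in [set: I])
      ((U ^~ i) @^-1` `[(j i)%:R * eps - rho, (j i).+1%:R * eps - rho[)).
    apply: fin_bigcap_measurable => // i _.
    by rewrite -[_ @^-1` _]setTI; apply: mU => //; exact: measurable_itv.
  apply/seteqP; split => w /=.
    by move=> <- i _ /=; rewrite -qitv ffunE inordK.
  move=> h; apply/ffunP => i; rewrite ffunE; apply/val_inj/eqP => /=.
  by rewrite inordK// qitv; exact: h.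
rewrite ffunE inordK//; have := eqxx (q w i); rewrite qitv in_itv/= => /andP[l u].
rewrite ger0_norm ?subr_ge0// lerBlDr ltW// (lt_le_trans u)// -natr1.
by rewrite mulrDl mul1r addrA [eps + _]addrC.
Qed.

(** * Replacing one variable by an independent average *)

Section decoupling.
Context dO (Omega : measurableType dO) (R : realType) (P : probability Omega R).
Context (G0 : set (set Omega)) (mG0 : G0 `<=` measurable).
Context dX (X : measurableType dX) (d : X -> X -> \bar R) (xi : Omega -> X).
Context (I : finType) (W : X -> I -> R) (U : Omega -> I -> R).
Context (k L beta rho : R) (Psi : (I -> R) -> \bar R).
Hypotheses (mxi : measurable_fun [set: Omega] xi).
Hypotheses (mW : forall i, measurable_fun [set: X] (W ^~ i)).
Hypotheses (Wb : forall x i, `|W x i| <= beta).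
Hypotheses (Wlip : forall x y i, (`|W x i - W y i|%:E <= L%:E * d x y)%E).
Hypotheses (mU : forall i (B : set R), measurable B -> <<s G0>> ((U ^~ i) @^-1` B)).
Hypotheses (Ub : forall w i, `|U w i| <= rho).
Hypotheses (b0 : 0 <= beta) (L0 : 0 < L) (k0 : 0 < k).
Hypotheses (d0 : forall x y, (0 <= d x y)%E) (dC : forall x y, d x y = d y x)
  (pPsi : potential k Psi).

Let V w := W (xi w).
Let kL0 : 0 < k * L. Proof. by rewrite mulr_gt0. Qed.

Let sub_measurable A : <<s G0>> A -> measurable A.
Proof. by apply: (smallest_sub _ mG0); exact: sigma_algebra_measurable. Qed.

Let mV i : measurable_fun [set: Omega] (V ^~ i).
Proof. exact: (measurableT_comp (mW i) mxi). Qed.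

Let mUO i : measurable_fun [set: Omega] (U ^~ i).
Proof. by move=> _ B mB; rewrite setTI; apply: sub_measurable; exact: mU. Qed.

(** Dividing by the product of the Lipschitz constants of [Psi] and [W] gives a function that is
    1-Lipschitz for [d], hence a competitor in [tau]. As [Psi] is finite, [fine] loses nothing. *)
Let test (v : I -> R) (x : X) : R := fine (Psi (fun i => v i + W x i)) / (k * L).

Let Psi_fin u : Psi u \is a fin_num.
Proof. by have [_ Psi0 Psioo _] := pPsi; rewrite ge0_fin_numE. Qed.

Let testE v x : Psi (fun i => v i + W x i) = ((k * L) * test v x)%:E.
Proof. by rewrite /test mulrC divfK ?gt_eqF// fineK. Qed.

Let test_ge0 v x : 0 <= test v x.
Proof.
by have [_ Psi0 _ _] := pPsi; rewrite divr_ge0 ?fine_ge0// ltW.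
Qed.

Let mtest v : measurable_fun [set: X] (test v).
Proof.
have [mPsi _ _ _] := pPsi.
apply: measurable_funM => //.
apply: measurableT_comp => //; apply: mPsi => i; exact: measurable_funD.
Qed.

Let test_lip v : lipschitz1 d (test v).
Proof.
have [_ _ _ lPsi] := pPsi.
have le x y : d x y != +oo%E -> test v x - test v y <= fine (d x y).
  move=> dxy; have dE : d x y = (fine (d x y))%:E by rewrite fineK// ge0_fin_numE// ltey.
  have := @lPsi (fun i => v i + W x i) (fun i => v i + W y i) (L * fine (d x y)).
  rewrite !testE -EFinD lee_fin mulrA -mulrDr ler_pM2l// => h.
  rewrite lerBlDl; apply: h => [|i]; first by rewrite mulr_ge0 ?fine_ge0// ltW.
  by rewrite opprD addrACA subrr add0r -lee_fin EFinM -dE.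
move=> x y; have [->|dxy] := eqVneq (d x y) +oo%E; first exact: leey.
have dE : d x y = (fine (d x y))%:E by rewrite fineK// ge0_fin_numE// ltey.
rewrite dE lee_fin ler_norml le// andbT lerNl opprB.
by rewrite dC le// dC.
Qed.

Let test_bound v : exists b : R, forall x, `|test v x| <= b.
Proof.
have [_ _ _ lPsi] := pPsi.
exists ((k * beta + fine (Psi v)) / (k * L)) => x; rewrite ger0_norm//.
rewrite ler_pM2r ?invr_gt0// -lee_fin EFinD !fineK// addeC.
by apply: lPsi => // i; rewrite addrC addKr.
Qed.

Let itest v : P.-integrable setT (EFin \o (test v \o xi)).
Proof.
have [b tb] := test_bound v.
apply: (@integrable_bounded _ _ _ _ _ b) => [|w]; last exact: tb.
exact: measurableT_comp.
Qed.

Let taud := tau P <<s G0>> d xi.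

Let swap_value v :
  ((k * L)%:E * 'E_P[test v \o xi] = avg P V Psi v)%E.
Proof.
rewrite unlock /avg; under [RHS]eq_integral => w _ do rewrite /V testE EFinM.
rewrite ge0_integralZl_EFin//; last exact: ltW.
- by move=> w _; rewrite lee_fin.
- by apply/measurable_EFinP; exact: measurableT_comp.
Qed.

Let Vb w i : `|V w i| <= beta. Proof. exact: Wb. Qed.

(* On each fibre of [kappa] the argument of [Psi] is a single test function, and
   all of them obey the essential upper bound whose L^1 norm is [tau]. *)
Lemma decoupling_disc (J : finType) (kappa : Omega -> J) (v : J -> I -> R) :
  (forall j, <<s G0>> (kappa @^-1` [set j])) ->
  (\sum_j \int[P]_(w in kappa @^-1` [set j]) Psi (fun i => v j i + V w i)%R
   <= \sum_j \int[P]_(w in kappa @^-1` [set j]) avg P V Psi (v j)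
      + (k * L)%:E * taud)%E.
Proof.
move=> mk.
have mk' j : measurable (kappa @^-1` [set j]) by exact: sub_measurable.
rewrite /taud /tau Lnorm1; set Y := [set h | _].
have [[mess ub] _] := ess_supremumP P Y.
set U0 := ess_supremum P Y in mess ub *.
have mU0 : measurable_fun [set: Omega] (fun w => `|U0 w|)%E.
  exact: measurableT_comp.
rewrite (ge0_integral_fibers P mk' mU0)//.
rewrite ge0_sume_distrr; last by move=> j _; exact: integral_ge0.
rewrite -big_split/=; apply: lee_sum => j _.
set A := kappa @^-1` [set j].
have [Yj YjP] := cond_expectation_ex mG0 (itest (v j)).
have [mYj iYj EYj] := YjP.
set m := ('E_P[test (v j) \o xi])%E.
have m0 : (0 <= m)%E.
  by rewrite /m unlock; apply: integral_ge0 => w _; rewrite lee_fin test_ge0.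
have mfin : m \is a fin_num.
  by rewrite /m unlock; exact: (integrable_fin_num measurableT (itest (v j))).
have ae_le : {ae P, forall w, (`|Yj w - fine m|%:E <= U0 w)%E}.
  by apply: ub; exists (test (v j)), Yj; split.
have mYjO : measurable_fun [set: Omega] (EFin \o Yj) by exact: measurable_int iYj.
have mA : measurable A by exact: mk'.
(* As [A] lies in the sigma-field of the past, the test function can be replaced by its conditional
   expectation, which is almost surely at most the mean plus the essential supremum. Passing to the
   positive part keeps the integrands nonnegative. *)
have PA : (\int[P]_(w in A) (test (v j) (xi w))%:E
           <= \int[P]_(w in A) (m + `|U0 w|))%E.
  rewrite -EYj; last exact: mk.
  apply: (@le_trans _ _ (\int[P]_(w in A) (EFin \o Yj)^\+ w)%E).
    by rewrite integralE -[leRHS]sube0; apply: leeB => //; exact: integral_ge0.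
  apply: ae_ge0_le_integral => //.
  - by apply: measurable_funTS; exact: measurable_funepos.
  - by move=> w _; exact: adde_ge0.
  - by apply: measurable_funTS; apply: emeasurable_funD.
  - apply: filterS ae_le => w le _.
    rewrite funeposE ge_max adde_ge0// andbT.
    rewrite -(fineK mfin) -leeBlDl// (le_trans _ (lee_abs _))//.
    by apply: le_trans le; rewrite lee_fin ler_norm.
(* The averaged function does not depend on [w]: it is [k * L] times the mean of the test
   function. *)
rewrite (_ : \int[P]_(w in A) avg _ _ _ _ = (k * L)%:E * \int[P]_(w in A) m)%E; last first.
  by rewrite -swap_value -/m ge0_integralZl_EFin// ltW.
rewrite -muleDr//; last by rewrite ge0_adde_def// inE integral_ge0.
rewrite -ge0_integralD//; last exact: measurable_funTS.
rewrite [leLHS](eq_integral (fun w => (k * L)%:E * (test (v j) (xi w))%:E)%E); last first.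
  by move=> w _; rewrite -EFinM; exact: testE.
rewrite ge0_integralZl_EFin//.
- by rewrite lee_pmul2l// lte_fin.
- by move=> w _; rewrite lee_fin.
- by apply/measurable_EFinP; apply: measurable_funTS; exact: measurableT_comp.
- exact: ltW.
Qed.

Lemma decoupling :
  (\int[P]_w Psi (fun i => U w i + V w i)%R
   <= \int[P]_w avg P V Psi (U w) + (k * L)%:E * taud)%E.
Proof.
have [mPsi Psi0 Psioo lPsi] := pPsi.
have [maPsi aPsi0 aPsioo laPsi] := avg_potential P mV Vb b0 (ltW k0) pPsi.
apply/lee_addgt0Pr => e e0.
(* The rounding of [U] is used twice, in [Psi] and in its average, at a cost of [k * e' = e / 2]
   each time. *)
pose e' := e / 2 / k.
have e'0 : 0 < e' by rewrite !divr_gt0.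
have mUT i : measurable_fun [set: g_sigma_algebraType G0]
    (U ^~ i : g_sigma_algebraType G0 -> R).
  by move=> _ B mB; rewrite setTI; exact: mU.
(* Rounding over the sigma-algebra generated by [G0], rather than that of [Omega], puts the fibres
   of [kappa] into the past, as [decoupling_disc] requires. *)
have [J [kappa [v [mk kv]]]] :=
  @discretize _ (g_sigma_algebraType G0) R I U rho e' mUT Ub e'0.
have mk' j : dO.-measurable (kappa @^-1` [set j]) by apply: sub_measurable; exact: mk.
have ke' : k * e' = e / 2 by rewrite /e' mulrC divfK// gt_eqF.
have mUV : measurable_fun [set: Omega] (fun w => Psi (fun i => U w i + V w i)).
  by apply: mPsi => i; exact: measurable_funD.
have mv i : measurable_fun [set: Omega] (fun w => v (kappa w) i).
  move=> _ B mB; rewrite setTI.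
  rewrite (_ : _ @^-1` _ = \bigcup_(j in [set j | B (v j i)]) (kappa @^-1` [set j])).
    by apply: fin_bigcup_measurable => // j _; exact: mk'.
  by apply/seteqP; split=> w /=; [exists (kappa w)|move=> [j Bj /= ->]].
have mvV : measurable_fun [set: Omega] (fun w => Psi (fun i => v (kappa w) i + V w i)).
  by apply: mPsi => i; exact: measurable_funD.
apply: (@le_trans _ _ (\int[P]_w (Psi (fun i => v (kappa w) i + V w i)%R + (e / 2)%:E))%E).
  apply: ge0_le_integral => //.
    by apply: emeasurable_funD.
  move=> w _; rewrite -ke'; apply: lPsi; first exact: ltW.
  by move=> i; rewrite opprD addrACA subrr addr0.
rewrite ge0_integralD_cst//; last by rewrite lee_fin ltW// divr_gt0.
rewrite [e in leRHS](splitr e) EFinD addeA leeD2r//.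
rewrite (ge0_integral_fibers P mk')//.
rewrite (eq_bigr (fun j => \int[P]_(w in kappa @^-1` [set j])
    Psi (fun i => v j i + V w i)%R)%E); last first.
  by move=> j _; apply: eq_integral => w; rewrite inE /= => ->.
apply: le_trans (decoupling_disc v mk) _.
rewrite [leRHS]addeAC leeD2r//.
rewrite -ge0_integralD_cst//; last 2 first.
  exact: maPsi.
  by rewrite lee_fin ltW// divr_gt0.
rewrite [leRHS](ge0_integral_fibers P mk')//.
- apply: lee_sum => j _; apply: ge0_le_integral => //.
  + by apply: measurable_funTS; apply: emeasurable_funD => //; exact: maPsi.
  + move=> w; rewrite -ke' /= => <-; apply: laPsi; first exact: ltW.
    by move=> i; rewrite distrC.
- by apply: emeasurable_funD => //; exact: maPsi.
- by move=> w; rewrite adde_ge0// lee_fin ltW// divr_gt0.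
Qed.

End decoupling.

(** * Iterated averages and exponential moments *)

Section iterated_average.
Context dO (Omega : measurableType dO) (R : realType) (P : probability Omega R).
Context (I J : Type) (V : J -> Omega -> I -> R) (beta k : R).
Hypotheses (mV : forall j i, measurable_fun [set: Omega] (V j ^~ i)).
Hypotheses (Vb : forall j w i, `|V j w i| <= beta).
Hypotheses (b0 : 0 <= beta) (k0 : 0 <= k).

(** The last index of [s] gives the innermost average, being the first to be replaced. *)
Definition iter_avg (s : seq J) (Psi : (I -> R) -> \bar R) : (I -> R) -> \bar R :=
  foldr (fun j Phi => avg P (V j) Phi) Psi s.

Lemma iter_avg_potential s Psi : potential k Psi -> potential k (iter_avg s Psi).
Proof.
by move=> pPsi; elim: s => //= j s IH; exact: (avg_potential P (mV j) (Vb j)).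
Qed.

(** Induction from the right: the last summand is replaced given the partial sum before it, and the
    resulting average is again a potential with the same [k], to which the induction hypothesis
    applies. *)
Lemma iter_decoupling (t : J -> \bar R) (s : seq J) :
  (forall s' j s'', s = s' ++ j :: s'' -> forall Phi, potential k Phi ->
     (\int[P]_w Phi (fun i => \sum_(j' <- s') V j' w i + V j w i)%R
      <= \int[P]_w avg P (V j) Phi (fun i => \sum_(j' <- s') V j' w i)%R + t j)%E) ->
  forall Psi, potential k Psi ->
    (\int[P]_w Psi (fun i => \sum_(j <- s) V j w i)%R
     <= iter_avg s Psi (fun=> 0%R) + \sum_(j <- s) t j)%E.
Proof.
elim/last_ind: s => [|s j IH] step Psi pPsi.
  rewrite big_nil adde0 /= (_ : (fun=> _) = fun=> Psi (fun=> 0)) ?integral_cst1//.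
  by apply/funext => w; congr Psi; apply/funext => i; rewrite big_nil.
have stepj := step s j [::] (esym (cats1 _ _)) Psi pPsi.
under eq_integral => w _ do under eq_fun => i do rewrite -cats1 big_cat big_seq1.
apply: (le_trans stepj); rewrite -cats1 big_cat big_seq1 /= addeA leeD2r//.
rewrite /iter_avg foldr_cat /= -/(iter_avg s _); apply: IH.
  move=> s1 j1 s2 sE; apply: (step _ _ (rcons s2 j)).
  by rewrite sE -!cats1 -catA.
exact: (avg_potential P (mV j) (Vb j)).
Qed.

Section exponential_bound.
Context (E : finType) (p q : E -> I) (t m : E -> R).
Hypotheses (m0 : forall e, 0 <= m e).

(** A family of majorants stable under averaging: the exponential of a sum factorizes, so an average
    only multiplies each coefficient by an exponential moment. *)
Definition exp_bound (a : R) (c : E -> R) (u : I -> R) : R :=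
  a + \sum_e c e * expR ((u (p e) - u (q e)) / t e).

Lemma avg_exp_bound (a : R) (c : E -> R) Psi j u : 0 <= a -> (forall e, 0 <= c e) ->
  potential k Psi -> (forall v, (Psi v <= (exp_bound a c v)%:E)%E) ->
  (forall e, (\int[P]_w (expR ((V j w (p e) - V j w (q e)) / t e))%:E <= (m e)%:E)%E) ->
  (avg P (V j) Psi u <= (exp_bound a (fun e => c e * m e) u)%:E)%E.
Proof.
move=> a0 c0 pPsi Pb mb.
pose h e w := expR ((V j w (p e) - V j w (q e)) / t e).
have mh e : measurable_fun [set: Omega] (h e).
  apply: measurableT_comp => //; apply: measurable_funM => //.
  exact: measurable_funB.
have h0 e w : 0 <= h e w by exact: expR_ge0.
pose C e := c e * expR ((u (p e) - u (q e)) / t e).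
have C0 e : 0 <= C e by rewrite mulr_ge0 ?expR_ge0.
have EC w : exp_bound a c (fun i => u i + V j w i) = a + \sum_e C e * h e w.
  rewrite /exp_bound; congr (_ + _); apply: eq_bigr => e _.
  by rewrite /C /h -mulrA -expRD -mulrDl opprD addrACA.
apply: (@le_trans _ _ (\int[P]_w (\sum_e (C e)%:E * (h e w)%:E + a%:E))%E).
  apply: ge0_le_integral => //.
  - by case: pPsi => _ + _ _ w _; exact.
  - exact: measurable_shift pPsi _.
  - apply: emeasurable_funD => //; apply: emeasurable_sum => e.
    by apply: emeasurable_funM => //; exact/measurable_EFinP.
  - move=> w _; apply: (le_trans (Pb _)); rewrite EC addrC EFinD -sumEFin.
    by under [X in (_ <= X + _)%E]eq_bigr do rewrite -EFinM.
rewrite ge0_integralD_cst//; last 2 first.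
- apply: emeasurable_sum => e.
  by apply: emeasurable_funM => //; exact/measurable_EFinP.
- by move=> w; apply: sume_ge0 => e _; rewrite -EFinM lee_fin mulr_ge0.
rewrite ge0_integral_sum//; last 2 first.
- by move=> e; apply: emeasurable_funM => //; exact/measurable_EFinP.
- by move=> e w _; rewrite -EFinM lee_fin mulr_ge0.
rewrite addeC /exp_bound EFinD leeD2l// -sumEFin; apply: lee_sum => e _.
rewrite ge0_integralZl_EFin//; last 2 first.
- by move=> w _; rewrite lee_fin.
- exact/measurable_EFinP.
rewrite mulrAC [leRHS]EFinM.
by apply: lee_wpmul2l; [rewrite lee_fin; exact: C0|exact: mb].
Qed.

Lemma iter_avg_exp_bound (a : R) (c : E -> R) Psi s u : 0 <= a ->
  (forall e, 0 <= c e) -> potential k Psi ->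
  (forall v, (Psi v <= (exp_bound a c v)%:E)%E) ->
  (forall j e,
    (\int[P]_w (expR ((V j w (p e) - V j w (q e)) / t e))%:E <= (m e)%:E)%E) ->
  (iter_avg s Psi u <= (exp_bound a (fun e => c e * m e ^+ size s) u)%:E)%E.
Proof.
move=> a0 c0 pPsi Pb mb; elim: s u => [|j s IH] u /=.
  apply: (le_trans (Pb _)); rewrite lee_fin /exp_bound.
  by rewrite lerD2l ler_sum// => e _; rewrite expr0 mulr1.
rewrite (_ : (fun e => _) = fun e => c e * m e ^+ size s * m e); last first.
  by apply/funext => e; rewrite exprSr mulrA.
apply: avg_exp_bound => //.
- by move=> e; rewrite mulr_ge0 ?exprn_ge0.
- exact: iter_avg_potential.
Qed.

End exponential_bound.
End iterated_average.

(** From [expR (- x) >= 1 - x] one gets [expR x <= (1 - x)^-1]; and (1 + x + 2x^2)(1 - x) = 1 +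
    x^2(1 - 2x) >= 1. *)
Lemma expR_le_quad (R : realType) (x : R) : `|x| <= 2^-1 ->
  expR x <= 1 + x + 2 * x ^+ 2.
Proof.
rewrite ler_norml => /andP[x1 x2].
have e1 : 1 - x <= expR (- x) by exact: expR_ge1Dx.
have x3 : 0 < 1 - x by lra.
apply: (@le_trans _ _ (1 - x)^-1).
  by rewrite -[x in expR x]opprK expRN lef_pV2 ?posrE// (lt_le_trans x3).
rewrite -[leLHS]mul1r ler_pdivrMr//; nra.
Qed.

(** The quadratic bound applies to [X / t]; its linear term has mean zero, and 1 + y <= exp y
    restores an exponential, convenient for taking powers. *)
Lemma mgf_bernstein dO (Omega : measurableType dO) (R : realType)
    (P : probability Omega R) (X : Omega -> R) (t sigma : R) :
  measurable_fun [set: Omega] X -> 0 < t -> (forall w, `|X w| <= t / 2) ->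
  (\int[P]_w (X w)%:E = 0)%E -> (\int[P]_w (X w ^+ 2)%:E <= (sigma ^+ 2)%:E)%E ->
  (\int[P]_w (expR (X w / t))%:E <= (expR (2 * sigma ^+ 2 / t ^+ 2))%:E)%E.
Proof.
move=> mX t0 Xb EX EX2.
have t2 : 0 <= t / 2 by rewrite divr_ge0// ltW.
have iX : P.-integrable setT (fun w => (X w)%:E) by exact: integrable_bounded Xb.
have iX2 : P.-integrable setT (fun w => (X w ^+ 2)%:E).
  apply: (@integrable_bounded _ _ _ _ _ ((t / 2) ^+ 2)) => [|w].
    exact: measurable_funX.
  by rewrite normrX lerXn2r ?nnegrE.
apply: (@le_trans _ _ (\int[P]_w (1 + ((t^-1)%:E * (X w)%:E
    + (2 * t^-1 ^+ 2)%:E * (X w ^+ 2)%:E)))%E).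
  apply: ge0_le_integral => //.
  - apply/measurable_EFinP; apply: measurableT_comp => //.
    exact: measurable_funM.
  - apply: emeasurable_funD => //; apply: emeasurable_funD.
      by apply: emeasurable_funM => //; exact/measurable_EFinP.
    by apply: emeasurable_funM => //; apply/measurable_EFinP; exact: measurable_funX.
  - move=> w _; rewrite -!EFinM -!EFinD lee_fin.
    apply: le_trans (expR_le_quad _) _.
      rewrite normrM normfV [X in _ / X]gtr0_norm// ler_pdivrMr// mulrC; exact: Xb.
    by rewrite exprMn; lra.
have iZX : P.-integrable setT (fun w => (t^-1)%:E * (X w)%:E)%E by exact: integrableZl.
have iZX2 : P.-integrable setT (fun w => (2 * t^-1 ^+ 2)%:E * (X w ^+ 2)%:E)%E.
  exact: integrableZl.
rewrite integralD//; last 2 first.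
- exact: finite_measure_integrable_cst.
- exact: integrableD.
rewrite integral_cst1 integralD// !integralZl// EX mule0 add0e.
apply: (@le_trans _ _ (1 + (2 * t^-1 ^+ 2 * sigma ^+ 2)%:E)%E).
  rewrite leeD2l// [leRHS]EFinM lee_wpmul2l// lee_fin mulr_ge0// exprn_ge0//.
  by rewrite invr_ge0 ltW.
rewrite -EFinD lee_fin; apply: le_trans (expR_ge1Dx _).
by rewrite lerD2l mulrAC exprVn.
Qed.
(** * Generic chaining *)

Section chaining.
Context (R : realType) (I : finType) (i0 : I).

(** The index [i0] contributes 0, so the default value 0 of the maximum changes nothing. *)
Definition max_excess (u : I -> R) : \bar R :=
  (\big[Num.max/0]_i (u i - u i0))%:E.

Lemma max_excess_potential : potential 2 max_excess.
Proof.
split.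
- move=> d T U mU; apply/measurable_EFinP.
  have H (s : seq I) :
      measurable_fun [set: T] (fun x => \big[Num.max/0]_(i <- s) (U x i - U x i0)).
    elim: s => [|i s IH].
      by under eq_fun do rewrite big_nil; exact: measurable_cst.
    under eq_fun do rewrite big_cons.
    by apply: measurable_maxr => //; exact: measurable_funB.
  exact: H.
- by move=> u; rewrite lee_fin; exact: bigmax_ge_id.
- by move=> u; exact: ltry.
- move=> u v delta delta0 uv; rewrite -EFinD lee_fin; apply: bigmax_le => [|i _].
    by rewrite addr_ge0 ?bigmax_ge_id ?mulr_ge0.
  apply: (@le_trans _ _ (v i - v i0 + 2 * delta)).
    have := uv i; have := uv i0; rewrite !ler_norml.
    by move=> /andP[? ?] /andP[? ?]; lra.
  by rewrite lerD2r; apply: le_bigmax.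
Qed.

Lemma sum_geometric_le2 (x : R) (n : nat) : 0 <= x ->
  \sum_(l < n) x / 2 ^+ l <= 2 * x.
Proof.
move=> x0; suff -> : \sum_(l < n) x / 2 ^+ l = 2 * x - 2 * x / 2 ^+ n.
  by rewrite lerBlDr lerDl !mulr_ge0// invr_ge0 exprn_ge0.
elim: n => [|n IH]; first by rewrite big_ord0 expr0 divr1 subrr.
rewrite big_ord_recr/= IH exprS; field.
by rewrite expf_neq0.
Qed.

Context (Lam : nat) (pi : nat -> I -> I).
Hypotheses (pi0 : forall i, pi 0%N i = i0) (piL : forall i, pi Lam i = i).

Definition link (l : nat) : {set I * I} := [set (pi l.+1 i, pi l i) | i : I]%SET.

Context (D sigma : I -> I -> R) (nu G1 G2 : R).
Hypotheses (D0 : forall a b, 0 <= D a b) (sigma0 : forall a b, 0 <= sigma a b).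
Hypotheses (nu0 : 0 <= nu) (G10 : 0 < G1) (G20 : 0 <= G2).
Hypothesis sumD : forall i,
  \sum_(l < Lam) 2 ^+ l * D (pi l.+1 i) (pi l i) <= G1.
Hypothesis sumsigma : forall i,
  \sum_(l < Lam) Num.sqrt (2 ^+ l) * sigma (pi l.+1 i) (pi l i) <= G2.
Hypothesis card_link : forall l, (l < Lam)%N ->
  #|link l|%:R <= expR (4 * 2 ^+ l) :> R.

(* The scale at which the increment over a link is exponentiated; the last
   summand only serves to keep it positive. *)
Definition link_scale (l : nat) (a b : I) : R :=
  4 * D a b + Num.sqrt nu / Num.sqrt (2 ^+ l) * sigma a b + G1 / 4 ^+ l.

(** The first summand outweighs the number of links at level [l], the second the exponential moments
    collected in at most [nu] averages. *)
Definition link_shift (l : nat) (a b : I) : R :=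
  4 * 2 ^+ l + nu * (2 * sigma a b ^+ 2 / link_scale l a b ^+ 2).

(** A bound on the scales of all links at level [l]; it decays geometrically, so summing over the
    levels costs only a factor 2. *)
Definition link_radius (l : nat) : R := (5 * G1 + Num.sqrt nu * G2) / 2 ^+ l.

Let sq2 (l : nat) : 0 < Num.sqrt (2 ^+ l : R).
Proof. by rewrite sqrtr_gt0 exprn_gt0. Qed.

Let sq2E (l : nat) : Num.sqrt (2 ^+ l : R) ^+ 2 = 2 ^+ l.
Proof. by rewrite sqr_sqrtr// exprn_ge0. Qed.

Lemma link_scale_gt0 l a b : 0 < link_scale l a b.
Proof.
rewrite /link_scale ltr_wpDl//; last by rewrite divr_gt0// exprn_gt0.
by rewrite addr_ge0 ?mulr_ge0 ?invr_ge0 ?sqrtr_ge0.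
Qed.

(** The scale is at least [Num.sqrt nu / Num.sqrt (2 ^+ l) * sigma a b], so the variance part of the
    shift gives 2 of the 6 multiples of the [sigma] term; the other 4 come from the scale itself
    times [4 * 2 ^+ l]. *)
Lemma link_scale_shift l a b : link_scale l a b * link_shift l a b <=
  16 * (2 ^+ l * D a b) + 6 * Num.sqrt nu * (Num.sqrt (2 ^+ l) * sigma a b)
  + 4 * G1 / 2 ^+ l.
Proof.
have t0 := link_scale_gt0 l a b.
have p0 : 0 < 2 ^+ l :> R by rewrite exprn_gt0.
have h1 : Num.sqrt nu * sigma a b <= link_scale l a b * Num.sqrt (2 ^+ l).
  rewrite -ler_pdivrMr// mulrAC /link_scale [4 * _ + _]addrC -addrA lerDl.
  by rewrite addr_ge0 ?mulr_ge0 ?divr_ge0 ?exprn_ge0// ltW.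
have h2 : nu * (2 * sigma a b ^+ 2 / link_scale l a b) <=
    2 * Num.sqrt nu * (Num.sqrt (2 ^+ l) * sigma a b).
  rewrite mulrA ler_pdivrMr// -[X in X * _ <= _](sqr_sqrtr nu0).
  have : 0 <= Num.sqrt nu * sigma a b by rewrite mulr_ge0 ?sqrtr_ge0.
  move=> /ler_wpM2l/(_ _ _ h1); lra.
have h3 : 4 * 2 ^+ l * link_scale l a b = 16 * (2 ^+ l * D a b)
    + 4 * Num.sqrt nu * (Num.sqrt (2 ^+ l) * sigma a b) + 4 * G1 / 2 ^+ l.
  rewrite /link_scale (_ : 4 ^+ l = (2 ^+ l) ^+ 2 :> R).
    move: (sq2 l) (sq2E l); move: (Num.sqrt (2 ^+ l)) => q q0 <-.
    by field; rewrite gt_eqF.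
  by rewrite -exprM mulnC exprM; congr (_ ^+ l); ring.
rewrite /link_shift mulrDr [_ * (4 * _)]mulrC h3.
have -> : link_scale l a b * (nu * (2 * sigma a b ^+ 2 / link_scale l a b ^+ 2))
  = nu * (2 * sigma a b ^+ 2 / link_scale l a b) by field; rewrite gt_eqF.
by lra.
Qed.

(** One term of a chaining sum is at most the whole sum, which accounts for [4 * G1] and for [G2];
    the last summand of the scale gives the fifth [G1]. *)
Lemma link_scale_le (l : nat) i : (l < Lam)%N ->
  link_scale l (pi l.+1 i) (pi l i) <= link_radius l.
Proof.
move=> lL; have p0 : 0 < 2 ^+ l :> R by rewrite exprn_gt0.
have hD : 2 ^+ l * D (pi l.+1 i) (pi l i) <= G1.
  apply: le_trans (sumD i); rewrite (bigD1 (Ordinal lL))//= lerDl sumr_ge0// => j _.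
  by rewrite mulr_ge0// exprn_ge0.
have hs : Num.sqrt (2 ^+ l) * sigma (pi l.+1 i) (pi l i) <= G2.
  apply: le_trans (sumsigma i).
  rewrite (bigD1 (Ordinal lL))//= lerDl sumr_ge0// => j _.
  by rewrite mulr_ge0// sqrtr_ge0.
rewrite /link_radius ler_pdivlMr// /link_scale !mulrDl.
have -> : Num.sqrt nu / Num.sqrt (2 ^+ l) * sigma (pi l.+1 i) (pi l i) * 2 ^+ l
   = Num.sqrt nu * (Num.sqrt (2 ^+ l) * sigma (pi l.+1 i) (pi l i)).
  move: (sq2 l) (sq2E l); move: (Num.sqrt (2 ^+ l)) => q q0 <-.
  by field; rewrite gt_eqF.
have hs' := ler_wpM2l (sqrtr_ge0 nu) hs.
have h4 : G1 / 4 ^+ l * 2 ^+ l <= G1.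
  rewrite mulrAC ler_pdivrMr ?exprn_gt0// ler_pM2l// lerXn2r ?nnegrE//; lra.
by lra.
Qed.

(** The index type contains all pairs at each level; those that are not links get weight 0. *)
Definition chain_weight (e : 'I_Lam * (I * I)) : R :=
  if e.2 \in link e.1 then
    link_radius e.1 * expR (- link_shift e.1 e.2.1 e.2.2) else 0.

Let G12 : 0 <= 5 * G1 + Num.sqrt nu * G2.
Proof. by rewrite addr_ge0 ?mulr_ge0 ?sqrtr_ge0// ltW. Qed.

Let radius_ge0 l : 0 <= link_radius l.
Proof. by rewrite /link_radius mulr_ge0// invr_ge0 exprn_ge0. Qed.

Lemma chain_weight_ge0 e : 0 <= chain_weight e.
Proof. by rewrite /chain_weight; case: ifP => // _; rewrite mulr_ge0 ?expR_ge0. Qed.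

Lemma chaining_path i :
  \sum_(l < Lam) link_scale l (pi l.+1 i) (pi l i) * link_shift l (pi l.+1 i) (pi l i)
  <= 24 * G1 + 6 * Num.sqrt nu * G2.
Proof.
apply: le_trans.
  by apply: ler_sum => l _; exact: link_scale_shift.
rewrite !big_split/= -!mulr_sumr.
have h1 := sumD i; have h2 := sumsigma i.
have h3 := @sum_geometric_le2 (4 * G1) Lam (mulr_ge0 (ler0n _ _) (ltW G10)).
rewrite -mulr_sumr in h3.
have h4 := ler_wpM2l (mulr_ge0 (ler0n R 6) (sqrtr_ge0 nu)) h2.
lra.
Qed.

(* [x <= t (s + exp (x / t - s))] for every [t > 0], applied with a scale and a
   shift depending on the link. *)
Lemma max_excess_le u : (max_excess u <=
  (exp_bound (fun e : 'I_Lam * (I * I) => e.2.1) (fun e => e.2.2)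
     (fun e => link_scale e.1 e.2.1 e.2.2)
     (24 * G1 + 6 * Num.sqrt nu * G2) chain_weight u)%:E)%E.
Proof.
rewrite lee_fin; set rhs := exp_bound _ _ _ _ _ _.
have rhsE : rhs = 24 * G1 + 6 * Num.sqrt nu * G2 +
    \sum_(l < Lam) \sum_ab chain_weight (l, ab) *
       expR ((u ab.1 - u ab.2) / link_scale l ab.1 ab.2).
  by rewrite /rhs /exp_bound pair_bigA /=; congr (_ + _); apply: eq_bigr => -[].
have term_ge0 l ab : 0 <= chain_weight (l, ab) *
    expR ((u ab.1 - u ab.2) / link_scale l ab.1 ab.2).
  by rewrite mulr_ge0 ?chain_weight_ge0 ?expR_ge0.
apply: bigmax_le => [|i _].
  rewrite rhsE addr_ge0//; last by apply: sumr_ge0 => l _; exact: sumr_ge0.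
  by rewrite addr_ge0 ?mulr_ge0 ?sqrtr_ge0// ltW.
(* Telescoping along the chain from [pi 0 i = i0] to [pi Lam i = i]. *)
have -> : u i - u i0 = \sum_(l < Lam) (u (pi l.+1 i) - u (pi l i)).
  rewrite -(big_mkord xpredT (fun l => u (pi l.+1 i) - u (pi l i))).
  by rewrite (telescope_sumr (fun l => u (pi l i)))// piL pi0.
rewrite rhsE; apply: le_trans (lerD (chaining_path i) (lexx _)).
rewrite -big_split/=; apply: ler_sum => l _.
set a := pi l.+1 i; set b := pi l i.
set t := link_scale l a b; set s := link_shift l a b.
have t0 : 0 < t by exact: link_scale_gt0.
apply: (@le_trans _ _ (t * s + t * (expR (- s) * expR ((u a - u b) / t)))).
  rewrite -mulrDr -ler_pdivrMl// mulrC -expRD.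
  by have := expR_ge1Dx (- s + (u a - u b) / t); lra.
rewrite lerD2l (bigD1 (a, b))//= -[leLHS]addr0 lerD//; last exact: sumr_ge0.
rewrite /chain_weight /= ifT; last by apply/imsetP; exists i.
by rewrite -mulrA ler_wpM2r ?mulr_ge0 ?expR_ge0// link_scale_le.
Qed.

(** After [n] averages the shift leaves at most [link_radius l * expR (- (4 * 2 ^+ l))] per link,
    and the number of links cancels the exponential. The radii then form a geometric series. *)
Lemma sum_chain_weight_le (n : nat) : n%:R <= nu ->
  \sum_(e : 'I_Lam * (I * I)) chain_weight e *
     expR (2 * sigma e.2.1 e.2.2 ^+ 2 / link_scale e.1 e.2.1 e.2.2 ^+ 2) ^+ n
  <= 10 * G1 + 2 * Num.sqrt nu * G2.
Proof.
move=> nnu; rewrite -(pair_bigA _ (fun l ab => chain_weight (l, ab) *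
     expR (2 * sigma ab.1 ab.2 ^+ 2 / link_scale l ab.1 ab.2 ^+ 2) ^+ n))/=.
apply: (@le_trans _ _ (\sum_(l < Lam) link_radius l)); last first.
  apply: le_trans (sum_geometric_le2 _ G12) _; lra.
apply: ler_sum => l _.
apply: (@le_trans _ _ (\sum_(ab in link l) link_radius l * expR (- (4 * 2 ^+ l)))).
  rewrite [leRHS]big_mkcond/=; apply: ler_sum => -[a b] _ /=.
  rewrite /chain_weight/=; case: ifPn => _; last by rewrite mul0r.
  rewrite -mulrA ler_wpM2l// -expRM_natl -expRD ler_expR /link_shift.
  set x := 2 * _ / _; have x0 : 0 <= x.
    by rewrite divr_ge0 ?mulr_ge0 ?exprn_ge0// ltW ?link_scale_gt0.
  have := ler_wpM2r x0 nnu; lra.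
rewrite sumr_const -[leLHS]mulr_natr -mulrA ler_piMr// expRN mulrC ler_pdivrMr ?expR_gt0//.
by rewrite mul1r card_link.
Qed.

(** At the zero argument every exponential of the bound equals 1, so the constants add up: 34 = 24 +
    10 and 8 = 6 + 2. *)
Lemma iter_avg_max_excess dO (Omega : measurableType dO) (P : probability Omega R)
    (J : Type) (V : J -> Omega -> I -> R) (beta : R) (s : seq J) :
  (forall j i, measurable_fun [set: Omega] (V j ^~ i)) ->
  (forall j w i, `|V j w i| <= beta) -> 0 <= beta -> (size s)%:R <= nu ->
  (forall j a b w, `|V j w a - V j w b| <= 2 * D a b) ->
  (forall j a b, \int[P]_w (V j w a - V j w b)%:E = 0)%E ->
  (forall j a b, (\int[P]_w ((V j w a - V j w b) ^+ 2)%:E <= (sigma a b ^+ 2)%:E)%E) ->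
  (iter_avg P V s max_excess (fun=> 0%R)
   <= (34 * G1 + 8 * Num.sqrt nu * G2)%:E)%E.
Proof.
move=> mV Vb b0 snu VD V0 V2.
have a0 : 0 <= 24 * G1 + 6 * Num.sqrt nu * G2.
  by rewrite addr_ge0 ?mulr_ge0 ?sqrtr_ge0// ltW.
have m0 (e : 'I_Lam * (I * I)) :
    0 <= expR (2 * sigma e.2.1 e.2.2 ^+ 2 / link_scale e.1 e.2.1 e.2.2 ^+ 2).
  exact: expR_ge0.
have := @iter_avg_exp_bound _ _ R P I J V beta 2 mV Vb b0 (ler0n _ _)
  _ _ _ _ _ m0 _ _ _ s (fun=> 0) a0 chain_weight_ge0
  max_excess_potential max_excess_le.
move=> /(_ _)/le_trans; apply.
  move=> j e; apply: mgf_bernstein => //.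
  - exact: measurable_funB.
  - exact: link_scale_gt0.
  - move=> w; apply: le_trans (VD _ _ _ _) _.
    (* The summand [4 * D] of the scale is there for this: increments of size [2 * D] are at most
       half the scale. *)
    suff : 4 * D e.2.1 e.2.2 <= link_scale e.1 e.2.1 e.2.2 by lra.
    rewrite /link_scale -addrA lerDl addr_ge0 ?mulr_ge0 ?invr_ge0 ?sqrtr_ge0//.
    exact: ltW.
rewrite lee_fin /exp_bound.
have := sum_chain_weight_le snu.
under [X in _ -> _ + X <= _]eq_bigr do rewrite subrr mul0r expR0 mulr1.
by move=> h; lra.
Qed.

End chaining.

(** * Comparison of norms, and centring *)

(* No measurability is required: neither [diam] nor a supremum over an uncountable
   class needs to be measurable. *)
Lemma ge0_le_integral_ub d (T : measurableType d) (R : realType)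
    (mu : {measure set T -> \bar R}) (f g : T -> \bar R) :
  (forall x, 0 <= f x)%E -> (forall x, f x <= g x)%E ->
  (\int[mu]_x f x <= \int[mu]_x g x)%E.
Proof.
move=> f0 fg; rewrite !ge0_integralTE//; last by move=> x; exact: le_trans (fg x).
apply: le_ereal_sup => _ [h hf <-]; exists h => // x.
exact: le_trans (hf x) (fg x).
Qed.

Lemma ge0_ler_poweR (R : realType) (r : R) (x y : \bar R) :
  0 <= r -> (0 <= x)%E -> (x <= y)%E -> (x `^ r <= y `^ r)%E.
Proof.
move=> r0 x0 xy; apply: gt0_ler_poweR => //; rewrite in_itv/= leey andbT//.
exact: le_trans xy.
Qed.

(** Jensen's inequality for [f ^+ 2], obtained from Hölder's against the constant 1; an essential
    supremum bound when [p] is infinite. The function [h] enters only by comparison, so that it may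
    be a diameter of a cell. *)
Lemma L2_norm_le d (T : measurableType d) (R : realType) (P : probability T R)
    (p : \bar R) (f : T -> R) (h : T -> \bar R) : (1 <= p)%E ->
  measurable_fun [set: T] f -> (forall x, `|f x|%:E <= h x)%E ->
  ((\int[P]_x (f x ^+ 2)%:E) `^ 2^-1 <= 'N[P]_(2%:E * p)[h])%E.
Proof.
move=> p1 mf fh.
have h0 x : (0 <= h x)%E by apply: le_trans (fh x); rewrite lee_fin.
set A := (\int[P]_x _)%E.
have A0 : (0 <= A)%E by apply: integral_ge0 => x _; rewrite lee_fin sqr_ge0.
case: p p1 => [r| |//]; last first.
  move=> _; rewrite gt0_muley ?lte_fin//.
  rewrite unlock /= probability_setT lte01.
  set e := ess_sup _ _.
  have e0 : (0 <= e)%E.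
    apply: ess_sup_gee; first by rewrite /= probability_setT lte01.
    by apply: nearW => x /=; exact: abse_ge0.
  have [->|eoo] := eqVneq e +oo%E; first exact: leey.
  have eE : e = (fine e)%:E by rewrite fineK// ge0_fin_numE// ltey.
  have : (A <= \int[P]_x ((fine e ^+ 2)%:E))%E.
    apply: ae_ge0_le_integral => //.
    - by move=> x _; rewrite lee_fin sqr_ge0.
    - by apply/measurable_EFinP; exact: measurable_funX.
    - by move=> x _; rewrite lee_fin sqr_ge0.
    - have := ess_sup_ge P (abse \o h); rewrite -/e; apply: filterS => x /= he _.
      rewrite lee_fin -[f x ^+ 2]real_normK ?num_real// lerXn2r ?nnegrE ?fine_ge0//.
      by rewrite -lee_fin -eE (le_trans _ he)// (le_trans (fh x))// lee_abs.
  rewrite integral_cst1 => Ae.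
  apply: le_trans (ge0_ler_poweR _ A0 Ae) _; first by rewrite invr_ge0.
  by rewrite poweR12_sqrt ?lee_fin ?sqr_ge0//= sqrtr_sqr ger0_norm ?fine_ge0// -eE.
rewrite lee_fin => r1; rewrite -EFinM unlock /=.
set B := (\int[P]_x _)%E.
have B0 : (0 <= B)%E by apply: integral_ge0 => x _; exact: poweR_ge0.
have fhr x : (((f x ^+ 2) `^ r)%R%:E <= `|h x| `^ (2 * r))%E.
  rewrite -[f x ^+ 2]real_normK ?num_real// -powR_mulrn// -powRrM.
  rewrite -poweR_EFin; apply: ge0_ler_poweR.
  - by rewrite mulr_ge0// (le_trans _ r1).
  - by rewrite lee_fin.
  - by rewrite gee0_abs.
have AB : (A <= B `^ r^-1)%E.
  (* At [r = 1] the exponent [(1 - r^-1)^-1] would be the inverse of 0, which is 0 and not a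
     conjugate exponent; the integrals are compared directly. *)
  have [re|rn] := eqVneq r 1.
    rewrite re invr1 poweRe1//; apply: ge0_le_integral_ub => x.
      by rewrite lee_fin sqr_ge0.
    by have := fhr x; rewrite re powRr1 ?sqr_ge0.
  have {}r1 : 1 < r by rewrite lt_neqAle eq_sym rn.
  have r0 : 0 < r by rewrite (lt_trans _ r1).
  have := @hoelder _ T R P (fun x => f x ^+ 2) (cst 1) r (1 - r^-1)^-1.
  have -> : ('N[P]_((1 - r^-1)^-1)%:E[EFin \o cst 1%R] = 1)%E.
    by rewrite [LHS]Lnorm_cst1 /= probability_setT poweR1r.
  rewrite mule1 Lnorm1.
  under eq_integral => x _ do rewrite /= mulr1 ger0_norm ?sqr_ge0//.
  rewrite -/A => /(_ _ _ r0) hA.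
  apply: le_trans (hA _ _ _ _) _ => //.
  - exact: measurable_funX.
  - by rewrite invr_gt0 subr_gt0 invf_lt1.
  - by rewrite invrK addrC subrK.
  rewrite unlock /=; apply: ge0_ler_poweR.
  - by rewrite invr_ge0 ltW.
  - by rewrite integral_ge0// => x _; exact: poweR_ge0.
  - apply: ge0_le_integral_ub => x; first by rewrite lee_fin powR_ge0.
    apply: le_trans (fhr x).
    by rewrite ger0_norm ?sqr_ge0.
apply: (@le_trans _ _ ((B `^ r^-1) `^ 2^-1)%E).
  by apply: ge0_ler_poweR => //; rewrite invr_ge0.
by rewrite -poweRrM invfM mulrC.
Qed.

Section centering.
Context d (T : measurableType d) (R : realType) (P : probability T R).
Context (X : T -> R) (b : R).
Hypotheses (mX : measurable_fun [set: T] X) (Xb : forall w, `|X w| <= b).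

Lemma expectation_bounded : ('E_P[X] = (fine 'E_P[X])%:E)%E.
Proof.
rewrite unlock fineK//.
exact: (integrable_fin_num measurableT (integrable_bounded P mX Xb)).
Qed.

Lemma expectation_le_bound : `|fine ('E_P[X])%E| <= b.
Proof.
rewrite -lee_fin -abse_EFin -expectation_bounded unlock.
apply: le_trans (le_abse_integral _ _ _) _ => //; first exact/measurable_EFinP.
rewrite -[leRHS](integral_cst1 P); apply: ge0_le_integral => //.
- by do 2 apply: measurableT_comp => //.
- by move=> w _; rewrite lee_fin.
Qed.

Lemma integral_center : (\int[P]_w (X w - fine 'E_P[X])%:E = 0)%E.
Proof.
under eq_integral do rewrite EFinB.
rewrite integralB_EFin//; last 2 first.
- exact: integrable_bounded Xb.
- exact: finite_measure_integrable_cst.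
rewrite [X in (_ - X)%E]integral_cst1 -expectation_bounded unlock subee//.
exact: (integrable_fin_num measurableT (integrable_bounded P mX Xb)).
Qed.

(** X^2 = (X - m)^2 + 2m(X - m) + m^2, and the middle term integrates to zero. *)
Lemma integral_sqr_center_le :
  (\int[P]_w ((X w - fine 'E_P[X]) ^+ 2)%:E <= \int[P]_w (X w ^+ 2)%:E)%E.
Proof.
set m := fine _.
have mXm : measurable_fun [set: T] (fun w => X w - m) by exact: measurable_funB.
have Xmb w : `|X w - m| <= b + b.
  by apply: le_trans (ler_normB _ _) _; rewrite lerD// expectation_le_bound.
have iXm : P.-integrable [set: T] (fun w => ((2 * m) * (X w - m))%:E).
  apply: (@integrable_bounded _ _ _ _ _ (`|2 * m| * (b + b))) => [|w].
    exact: measurable_funM.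
  by rewrite normrM ler_wpM2l.
have iXm2 : P.-integrable [set: T] (fun w => ((X w - m) ^+ 2)%:E).
  apply: (@integrable_bounded _ _ _ _ _ ((b + b) ^+ 2)) => [|w].
    exact: measurable_funX.
  by rewrite normrX lerXn2r ?nnegrE// (le_trans _ (Xmb w)).
have im : P.-integrable [set: T] (fun=> (m ^+ 2)%:E).
  exact: finite_measure_integrable_cst.
rewrite [leRHS](eq_integral (fun w => ((X w - m) ^+ 2)%:E +
    (((2 * m) * (X w - m))%:E + (m ^+ 2)%:E))%E); last first.
  by move=> w _; rewrite -!EFinD; congr EFin; ring.
rewrite integralD//; last exact: integrableD.
rewrite leeDl// integralD// integral_cst1.
under eq_integral do rewrite EFinM.
rewrite integralZl//; last exact: integrable_bounded Xmb.
by rewrite integral_center mule0 add0e lee_fin sqr_ge0.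
Qed.

End centering.

(** * Partition sequences and the chaining net *)

Section partitions.
Context (R : realType) (T : Type) (F : set (T -> R)).

Lemma cell_refine (s : R) (Pi : nat -> set (set (T -> R))) (l : nat) f g :
  admissible s F Pi -> cell (Pi l.+1) f g -> cell (Pi l) f g.
Proof.
move=> [_ ref _ _] [A [PiA Af Ag]]; have [A' PiA' AA'] := ref _ _ PiA.
by exists A'; split=> //; exact: AA'.
Qed.

Lemma le_diam (Pi : set (set (T -> R))) (f g h : T -> R) (z : T) :
  cell Pi f g -> cell Pi f h -> (`|g z - h z|%:E <= diam Pi f z)%E.
Proof. by move=> fg fh; apply: ereal_sup_ubound; exists (g, h). Qed.

(** Cells are numbered by the bijection behind their cardinality; being nonempty, they attain every
    number. The bound for order [s] is at most that for order 1 because [s >= 1]. *)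
Lemma admissible_index (s : R) (Pi : nat -> set (set (T -> R))) (l : nat) :
  1 <= s -> admissible s F Pi ->
  exists k (idx : (T -> R) -> nat),
    [/\ k%:R <= 2 ^+ (2 ^ l) :> R,
        forall f, F f -> (idx f < k)%N,
        forall f g, F f -> F g -> idx f = idx g <-> cell (Pi l) f g &
        forall j, (j < k)%N -> exists2 f, F f & idx f = j].
Proof.
move=> s1 [part _ card0 cardS].
have [k Pik kle] : exists2 k, (Pi l #= `I_k)%card & k%:R <= 2 ^+ (2 ^ l) :> R.
  case: l => [|l]; first by exists 1%N => //; rewrite expn0 expr1 ler1n.
  have [k Pik kle] := cardS l.+1 isT; exists k => //.
  apply: (le_trans kle).
  have -> : 2 ^+ (2 ^ l.+1) = 2 `^ (2 `^ l.+1%:R) :> R.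
    by rewrite [2 `^ l.+1%:R]powR_mulrn// -(natrX R 2 l.+1) powR_mulrn.
  rewrite ler_powR ?ler1n// ler_powR ?ler1n// ler_pdivrMr ?(lt_le_trans _ s1)//.
  by rewrite ler_peMr.
have /card_set_bijP[phi [phifun phiinj phisurj]] := Pik.
have [cov triv ne] := part l.
pose C f := xget set0 [set A | Pi l A /\ A f].
have CP f : F f -> Pi l (C f) /\ C f f.
  move=> Ff; apply: (@xgetPex _ _ [set A | Pi l A /\ A f]).
  by move: Ff; rewrite -cov => -[A PiA Af]; exists A.
have Cuniq f A : F f -> Pi l A -> A f -> C f = A.
  move=> Ff PiA Af; have [PiC Cf] := CP _ Ff.
  by apply: triv => //; exists f.
exists k, (phi \o C); split => //.
- by move=> f Ff; apply: phifun; have [] := CP _ Ff.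
- move=> f g Ff Fg; have [PiCf Cff] := CP _ Ff; have [PiCg Cgg] := CP _ Fg.
  split=> [/= eq|[A [PiA Af Ag]] /=].
    have CC : C f = C g by apply: phiinj; rewrite ?inE.
    by exists (C f); split=> //; rewrite CC.
  by rewrite (Cuniq f A)// (Cuniq g A).
- move=> j jk; have [A PiA Aj] := phisurj _ jk; have [f Af] := ne _ PiA.
  have Ff : F f by rewrite -cov; exists A.
  by exists f => //=; rewrite (Cuniq f A).
Qed.

Lemma cell_top (s : R) (Pi : nat -> set (set (T -> R))) f g : 1 <= s ->
  admissible s F Pi -> F f -> F g -> cell (Pi 0%N) f g.
Proof.
move=> s1 adm Ff Fg; have [part _ card0 _] := adm.
have /card_set_bijP[phi [phifun phiinj _]] := card0.
have [cov _ _] := part 0%N.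
move: (Ff) (Fg); rewrite -cov => -[A PiA Af] [B PiB Bg].
suff AB : A = B by exists A; split=> //; rewrite AB.
apply: phiinj; rewrite ?inE//.
have := phifun _ PiA; have := phifun _ PiB; rewrite /= !ltnS !leqn0.
by move=> /eqP-> /eqP->.
Qed.

(* The [g i] represent the cells of [Pi1 Lam], and [pi l i] is a representative of
   the cell of [g i] in the common refinement of [Pi1 l] and [Pi2 l], which has at
   most [2 ^ (2 * 2 ^ l)] cells. *)
Lemma chaining_net (a b : R) (Pi1 Pi2 : nat -> set (set (T -> R))) (Lam : nat) :
  1 <= a -> 1 <= b -> (0 < Lam)%N -> F (cst 0) ->
  admissible b F Pi1 -> admissible a F Pi2 ->
  exists (I : finType) (i0 : I) (g : I -> T -> R) (pi : nat -> I -> I),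
    [/\ (forall i, F (g i)) /\ g i0 = cst 0,
        forall f, F f -> exists i, cell (Pi1 Lam) f (g i),
        (forall i, pi 0%N i = i0) /\ (forall i, pi Lam i = i),
        forall l i, cell (Pi1 l) (g i) (g (pi l i)) /\
                    cell (Pi2 l) (g i) (g (pi l i)) &
        forall l, #|link pi l|%:R <= expR (4 * 2 ^+ l) :> R].
Proof.
move=> a1 b1 L0 F0 adm1 adm2.
have [k1 /choice[idx1 H1]] := choice (fun l => admissible_index l b1 adm1).
have [k2 /choice[idx2 H2]] := choice (fun l => admissible_index l a1 adm2).
have lt1 l f : F f -> (idx1 l f < k1 l)%N by have [_ h _ _] := H1 l; exact: h.
have lt2 l f : F f -> (idx2 l f < k2 l)%N by have [_ h _ _] := H2 l; exact: h.
have eq1 l f g : F f -> F g -> idx1 l f = idx1 l g <-> cell (Pi1 l) f g.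
  by have [_ _ h _] := H1 l; exact: h.
have eq2 l f g : F f -> F g -> idx2 l f = idx2 l g <-> cell (Pi2 l) f g.
  by have [_ _ h _] := H2 l; exact: h.
pose I := 'I_(k1 Lam).
(* The cell of the zero function is represented by that function itself, so that [g i0] is zero. *)
have /choice[g gP] : forall j : I, exists g, [/\ F g, idx1 Lam g = j &
    idx1 Lam (cst 0) = j -> g = cst 0].
  move=> j; have [_ _ _ h] := H1 Lam.
  have [j0|j0] := eqVneq (idx1 Lam (cst 0)) j; first by exists (cst 0).
  have [f Ff fj] := h _ (ltn_ord j); exists f; split=> // /eqP.
  by rewrite (negbTE j0).
have gF i : F (g i) by have [] := gP i.
pose i0 : I := Ordinal (lt1 Lam _ F0).
pose c l (i : I) : 'I_(k1 l) * 'I_(k2 l) :=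
  (Ordinal (lt1 l _ (gF i)), Ordinal (lt2 l _ (gF i))).
have cP l i j : c l i = c l j <-> cell (Pi1 l) (g i) (g j) /\ cell (Pi2 l) (g i) (g j).
  rewrite -eq1// -eq2//; split=> [[? ?]//|[e1 e2]].
  by congr (_, _); exact/val_inj.
(* All members of a cell receive the same representative, so [pi l i] depends only on the cell of
   [i]. At level 0, where there is a single cell, it is forced to be [i0]. *)
pose pi l (i : I) := if l is 0%N then i0 else odflt i [pick j | c l j == c l i].
have pic l i : (0 < l)%N -> c l (pi l i) = c l i.
  case: l => // l _; rewrite /pi; case: pickP => [j /eqP//|/(_ i)].
  by rewrite eqxx.
have c_refine l i j : c l.+1 i = c l.+1 j -> c l i = c l j.
  move=> /cP[h1 h2]; apply/cP; split; first exact: (cell_refine adm1 h1).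
  exact: (cell_refine adm2 h2).
have picst l i j : c l i = c l j -> pi l i = pi l j.
  case: l => // l cij; rewrite /pi.
  under eq_pick do rewrite cij.
  by case: pickP => // /(_ j); rewrite eqxx.
exists I, i0, g, pi; split.
- by split=> //; have [_ _] := gP i0; apply.
- move=> f Ff; exists (Ordinal (lt1 Lam _ Ff)); apply/eq1 => //.
  by have [_ ->] := gP (Ordinal (lt1 Lam _ Ff)).
(* Each cell of [Pi1 Lam] contains exactly one point of the net, so at level [Lam] a point is its
   own representative. *)
- split=> // i; have /(f_equal (fun x => x.1)) := pic Lam i L0.
  move=> /(f_equal val)/=.
  by have [_ -> _] := gP (pi Lam i); have [_ -> _] := gP i => /val_inj.
- case=> [|l] i; first by split; [exact: (cell_top b1 adm1)|exact: (cell_top a1 adm2)].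
  by apply/cP; rewrite pic.
- move=> l; pose h i := (pi l.+1 i, pi l i).
  (* A cell at level [l.+1] determines the cell at level [l], hence the link; there are thus no more
     links than cells of the common refinement at level [l.+1]. *)
  have -> : link pi l = [set h (odflt i0 [pick i | c l.+1 i == v])
      | v in [set c l.+1 i | i : I]]%SET.
    apply/setP => ab; apply/imsetP/imsetP => [[i _ ->]|[v /imsetP[i _ ->] ->]].
      exists (c l.+1 i); first by apply/imsetP; exists i.
      case: pickP => [j /eqP cji|/(_ i)]; last by rewrite eqxx.
      by rewrite /h (picst _ _ _ cji) (picst _ _ _ (c_refine _ _ _ cji)).
    by eexists; last by rewrite /h.
  have le : (#|[set h (odflt i0 [pick i | c l.+1 i == v])
      | v in [set c l.+1 i | i : I]]%SET|
      <= k1 l.+1 * k2 l.+1)%N.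
    apply: leq_trans (leq_imset_card _ _) _; apply: leq_trans (max_card _) _.
    by rewrite card_prod !card_ord.
  rewrite -(ler_nat R) natrM in le; apply: le_trans le _.
  have [h1 _ _ _] := H1 l.+1; have [h2 _ _ _] := H2 l.+1.
  apply: le_trans (ler_pM _ _ h1 h2) _; rewrite // -exprD.
  rewrite (_ : 4 * 2 ^+ l = (2 ^ l.+1 + 2 ^ l.+1)%:R * 1 :> R); last first.
    by rewrite addnn -mul2n expnS mulnA mulr1 natrM natrX.
  rewrite expRM_natl lerXn2r ?nnegrE ?expR_ge0//.
  by apply: le_trans (expR_ge1Dx 1); rewrite -natr1.
Qed.

End partitions.

Lemma partial_sum_le_series (R : realType) (u : nat -> \bar R) (v : nat -> R) (G : R)
    (n : nat) : (forall l, 0 <= u l)%E -> (\sum_(0 <= l <oo) u l <= G%:E)%E ->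
  (forall l, (v l)%:E <= u l)%E -> \sum_(l < n) v l <= G.
Proof.
move=> u0 uG vu; rewrite -lee_fin; apply: le_trans uG.
rewrite -sumEFin; apply: (@le_trans _ _ (\sum_(l < n) u l)%E).
  by apply: lee_sum => l _; exact: vu.
rewrite -(big_mkord xpredT u); exact: nneseries_lim_ge.
Qed.
(** * The empirical process *)

Lemma sup_empirical_ge0 dO (Omega : measurableType dO) (R : realType)
    (P : probability Omega R) (T : Type) (N : finType) (Z : N -> Omega -> T)
    (F : set (T -> R)) w : F (cst 0) ->
  (0 <= ereal_sup [set (empirical P Z f w)%:E | f in F])%E.
Proof.
move=> F0; apply: ereal_sup_ubound; exists (cst 0) => //; congr EFin.
rewrite /empirical big1 ?mulr0// => x _ /=.
by rewrite (_ : cst 0 \o _ = cst 0)// expectation_cst subrr.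
Qed.

Lemma sup_norm_ge0 (R : realType) (T : Type) (h : T -> \bar R) (z : T) :
  (0 <= sup_norm h)%E.
Proof.
apply: (@le_trans _ _ `|h z|%E); first exact: abse_ge0.
by apply: ereal_sup_ubound; exists z.
Qed.

(** * Decoupling within a colour class *)

Section color_class.
Context dO (Omega : measurableType dO) (R : realType) (P : probability Omega R).
Context dZ (Zs : measurableType dZ) (N : finType) (Z : N -> {RV P >-> Zs}).
Context (F : set (Zs -> R)) (I : finType) (g : I -> Zs -> R) (L : R).
Hypotheses (F0 : F (cst 0)) (gF : forall i, F (g i)).
Hypotheses (mg : forall i, measurable_fun [set: Zs] (g i)).
Hypotheses (gL : forall i z, `|g i z| <= L) (L0 : 0 < L).
Context (K : nat) (kappa : 'I_#|N| -> 'I_K).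

Let B := @singletons N.

Definition centered (m : 'I_#|N|) (w : Omega) (i : I) : R :=
  g i (Z (enum_val m) w) - fine ('E_P[g i \o Z (enum_val m)])%E.

Definition color_class (k : 'I_K) : seq 'I_#|N| :=
  [seq m <- enum 'I_#|N| | kappa m == k].

Let mgZ (x : N) i : measurable_fun [set: Omega] (g i \o Z x).
Proof. exact: measurableT_comp. Qed.

Lemma measurable_centered m i : measurable_fun [set: Omega] (centered m ^~ i).
Proof. by apply: measurable_funB => //; exact: mgZ. Qed.

Let EgL (x : N) i : `|fine ('E_P[g i \o Z x])%E| <= L.
Proof. by apply: expectation_le_bound => // w; exact: gL. Qed.

Lemma centered_le m w i : `|centered m w i| <= L + L.
Proof. by apply: le_trans (ler_normB _ _) _; exact: lerD. Qed.

Let T m := #|B m|.-tuple Zs.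
(** The block has one element, but [#|B m|] is not convertible to 1; summing over the tuple avoids a
    cast. *)
Let W m (x : T m) (i : I) : R :=
  \sum_(s < #|B m|) g i (tnth x s) - fine ('E_P[g i \o Z (enum_val m)])%E.

Let WE m : centered m = fun w => W (block Z (B m) w).
Proof.
apply/funext => w; apply/funext => i; rewrite /W /centered; congr (_ - _).
under eq_bigr do rewrite tnth_mktuple.
by rewrite -(big_enum_val (fun x => g i (Z x w))) big_set1.
Qed.

Let card_singleton m : #|B m| = 1%N. Proof. exact: cards1. Qed.

Let mW m i : measurable_fun [set: T m] (@W m ^~ i).
Proof.
apply: measurable_funB => //; apply: measurable_sum => s.
by apply: (measurableT_comp (mg i)); exact: measurable_tnth.
Qed.

Let Wb m (x : T m) i : `|W x i| <= L + L.
Proof.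
apply: le_trans (ler_normB _ _) _; rewrite lerD//.
apply: le_trans (ler_norm_sum _ _ _) _.
apply: le_trans (ler_sum _ (fun s _ => gL i (tnth x s))) _.
by rewrite sumr_const card_ord card_singleton.
Qed.

(** Dividing by the uniform bound [L] puts the net functions into the cone; this is the source of
    the factor [L] in [Wlip]. *)
Let gcone i : cone F (fun z => L^-1 * g i z).
Proof.
exists (g i), L^-1; split=> //; first by rewrite invr_gt0.
apply: ge_ereal_sup => _ [z _ <-] /=.
by rewrite lee_fin normrM gtr0_norm ?invr_gt0// ler_pdivrMl// mulr1.
Qed.

Let cone_sup_ge0 z z' :
  (0 <= ereal_sup [set `|f z - f z'|%:E | f in cone F])%E.
Proof.
apply: (@le_trans _ _ `|0 - 0 : R|%:E); first by rewrite lee_fin.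
apply: ereal_sup_ubound; exists (cst 0) => //.
exists (cst 0), 1; split=> //; first by apply/funext => x; rewrite mul1r.
by apply: ge_ereal_sup => _ [x _ <-] /=; rewrite normr0 lee_fin.
Qed.

Let Wlip m (x y : T m) i :
  (`|W x i - W y i|%:E <= L%:E * dist_class (cone F) x y)%E.
Proof.
rewrite /W opprD addrACA subrr addr0 -sumrB /dist_class ge0_sume_distrr//.
apply: (@le_trans _ _ (\sum_(s < #|B m|) `|g i (tnth x s) - g i (tnth y s)|%:E)%E).
  by rewrite sumEFin lee_fin ler_norm_sum.
apply: lee_sum => s _; rewrite -lee_pdivrMl//.
apply: ereal_sup_ubound; exists (fun z => L^-1 * g i z); first exact: gcone.
by rewrite -mulrBr normrM gtr0_norm ?invr_gt0.
Qed.

Let past (m : 'I_#|N|) (k : 'I_K) : {set N} :=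
  (\bigcup_(m' < #|N| | (kappa m' == k) && (m' < m)%N) B m')%SET.

Let taum k m := tau P (sigma_gen Z (past m k))
  (@dist_class R Zs (cone F) #|B m|) (block Z (B m)).

(** A colour class is listed in increasing order, so what precedes [m] belongs to the past that
    [tau_bar] conditions on. *)
Lemma color_class_split k s' m s'' : color_class k = s' ++ m :: s'' ->
  kappa m = k /\ forall m', m' \in s' -> (kappa m' == k) && (m' < m)%N.
Proof.
move=> sE.
have mem x : x \in color_class k -> kappa x == k.
  by rewrite mem_filter => /andP[].
have srt : sorted (relpre val ltn) (color_class k).
  apply: sorted_filter; first by move=> ? ? ?; exact: ltn_trans.
  by rewrite -sorted_map val_enum_ord; exact: iota_ltn_sorted.
split; first by apply/eqP/mem; rewrite sE mem_cat inE eqxx orbT.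
move=> m' m's'; rewrite mem ?sE ?mem_cat ?m's'//=.
move: srt; rewrite sE sorted_pairwise; last by move=> ? ? ?; exact: ltn_trans.
rewrite pairwise_cat => /andP[/allrelP h _].
by apply: h => //; rewrite inE eqxx.
Qed.

Lemma sum_centered_le s w i :
  `|\sum_(m <- s) centered m w i| <= (L + L) *+ size s.
Proof.
elim: s => [|m s IH]; first by rewrite big_nil normr0.
by rewrite big_cons mulrS (le_trans (ler_normD _ _))// lerD// centered_le.
Qed.

(** The factor [2 * L] is the constant 2 of the potential times the Lipschitz constant [L] of
    [W]. *)
Lemma color_class_decoupling k (Psi : (I -> R) -> \bar R) : potential 2 Psi ->
  (\int[P]_w Psi (fun i => \sum_(m <- color_class k) centered m w i)%R <=
   iter_avg P centered (color_class k) Psi (fun=> 0%R)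
   + \sum_(m | kappa m == k) (2 * L)%:E * taum k m)%E.
Proof.
have LL0 : 0 <= L + L by rewrite addr_ge0 ?ltW.
move=> pPsi.
have -> : (\sum_(m | kappa m == k) (2 * L)%:E * taum k m =
           \sum_(m <- color_class k) (2 * L)%:E * taum k m)%E.
  by rewrite /color_class big_filter big_enum_cond.
apply: (iter_decoupling measurable_centered centered_le LL0 (ler0n R 2)) => //.
move=> s' m s'' sE Phi pPhi.
have [mk s'm] := color_class_split sE.
have mgen : [set E | exists2 x, x \in past m k &
    exists2 U, measurable U & E = Z x @^-1` U] `<=` dO.-measurable.
  by move=> _ [x _ [U mU ->]]; exact: measurable_funPTI.
rewrite WE; apply: (decoupling P mgen _ (@mW m) (@Wb m) (@Wlip m) _
  (sum_centered_le s') LL0 L0 _ _ _ pPhi) => //.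
- apply/measurable_fun_tnthP => s.
  rewrite (_ : _ \o _ = Z (enum_val s)); first exact: measurable_funPT.
  by apply/funext => w /=; rewrite tnth_mktuple.
(* The partial sum depends only on variables of the past, hence is measurable for the sigma-field
   they generate. *)
- move=> i U mU; pose T' := g_sigma_algebraType [set E | exists2 x, x \in past m k &
    exists2 U, measurable U & E = Z x @^-1` U].
  suff h : measurable_fun [set: T'] (fun w => \sum_(m' <- s') centered m' w i).
    by have := h measurableT U mU; rewrite setTI.
  elim: s' {sE} s'm => [|m' s' IH] s'm.
    rewrite (_ : (fun w : T' => _) = cst 0); first exact: measurable_cst.
    by apply/funext => w; rewrite big_nil.
  rewrite (_ : (fun w : T' => _) =
      fun w => centered m' w i + \sum_(m0 <- s') centered m0 w i); last first.
    by apply/funext => w; rewrite big_cons.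
  apply: measurable_funD; last by apply: IH => x xs; apply: s'm; rewrite inE xs orbT.
  apply: measurable_funB => // _ A mA; rewrite setTI.
  apply: sub_gen_smallest; exists (enum_val m').
    apply/bigcupP; exists m'; first by apply: s'm; rewrite inE eqxx.
    by rewrite inE.
  exists (g i @^-1` A) => //; rewrite -[_ @^-1` _]setTI; exact: mg.
- by move=> x y; apply: sume_ge0 => s _; exact: cone_sup_ge0.
- move=> x y; apply: eq_bigr => s _; congr ereal_sup; apply/seteqP.
  by split=> _ [f cf <-]; exists f => //; rewrite distrC.
Qed.

End color_class.
Lemma weighted_series_terms (R : realType) (u : nat -> \bar R) (v : nat -> R) (G : R) :
  (forall l, 0 <= u l)%E -> (forall l, 0 < v l) ->
  (\sum_(0 <= l <oo) (v l)%:E * u l <= G%:E)%E ->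
  (forall l, u l = (fine (u l))%:E) /\
  (forall n, \sum_(l < n) v l * fine (u l) <= G).
Proof.
move=> u0 v0 uG.
have vu0 l : (0 <= (v l)%:E * u l)%E by rewrite mule_ge0// lee_fin ltW.
have uE l : u l = (fine (u l))%:E.
  rewrite fineK// ge0_fin_numE// ltey; apply/eqP => uy.
  suff : (+oo <= G%:E)%E by [].
  apply: le_trans uG; rewrite (nneseriesD1 (n := l))// uy gt0_muley ?lte_fin//.
  by rewrite addye// gt_eqF// (lt_le_trans (ltNyr 0))// nneseries_ge0.
split=> // n; apply: (@partial_sum_le_series _ (fun l => (v l)%:E * u l)%E
  (fun l => v l * fine (u l))) => // l.
by rewrite EFinM -uE.
Qed.

Lemma expectationB_bounded d (T : measurableType d) (R : realType)
    (P : probability T R) (X Y : T -> R) (b : R) :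
  measurable_fun [set: T] X -> measurable_fun [set: T] Y ->
  (forall w, `|X w| <= b) -> (forall w, `|Y w| <= b) ->
  fine ('E_P[X])%E - fine ('E_P[Y])%E = fine ('E_P[(fun w => X w - Y w)%R])%E.
Proof.
move=> mX mY Xb Yb; apply/EFin_inj.
have XYb w : `|X w - Y w| <= b + b.
  by apply: le_trans (ler_normB _ _) _; rewrite lerD.
have mXY : measurable_fun [set: T] (fun w => X w - Y w) by exact: measurable_funB.
rewrite -(expectation_bounded P mXY XYb) EFinB.
rewrite -(expectation_bounded P mX Xb) -(expectation_bounded P mY Yb) unlock.
rewrite -integralB_EFin//; [exact: integrable_bounded Xb|exact: integrable_bounded Yb].
Qed.

(** * The bound for two given partition sequences *)

Section empirical_bound.
Context dO (Omega : measurableType dO) (R : realType) (P : probability Omega R).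
Context dZ (Zs : measurableType dZ) (N : finType) (Z : N -> {RV P >-> Zs}).
Context (F : set (Zs -> R)) (a b G1 G2 : R) (p : \bar R).
Context (Pi1 Pi2 : nat -> set (set (Zs -> R))).
Hypotheses (F0 : F (cst 0)).
Hypotheses (mF : forall f, F f -> measurable_fun [set: Zs] f).
Hypotheses (b1 : 1 <= b) (p1 : (1 <= p)%E).
Hypotheses (adm1 : admissible b F Pi1) (adm2 : admissible a F Pi2).
Hypotheses (G10 : 0 < G1) (G20 : 0 <= G2) (z0 : Zs).
Hypothesis gamma1 : forall f, F f ->
  (\sum_(0 <= l <oo) (2 `^ (l%:R / 1))%:E * sup_norm (diam (Pi1 l) f) <= G1%:E)%E.
Hypothesis gamma2 : forall f, F f ->
  (\sum_(0 <= l <oo) (2 `^ (l%:R / 2))%:E *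
     max_Lnorm Z (2%:E * p) (diam (Pi2 l) f) <= G2%:E)%E.

Let e1 l f := fine (sup_norm (diam (Pi1 l) f)).
Let e2 l f := fine (max_Lnorm Z (2%:E * p) (diam (Pi2 l) f)).

Let max_Lnorm_ge0 (h : Zs -> \bar R) : (0 <= max_Lnorm Z (2%:E * p) h)%E.
Proof. exact: bigmax_ge_id. Qed.

Let e1E l f : F f -> sup_norm (diam (Pi1 l) f) = (e1 l f)%:E.
Proof.
move=> Ff.
have [h _] := weighted_series_terms (fun l => sup_norm_ge0 _ z0)
  (fun l => powR_gt0 (l%:R / 1) (ltr0n R 2)) (gamma1 Ff).
exact: h.
Qed.

Let e2E l f : F f -> max_Lnorm Z (2%:E * p) (diam (Pi2 l) f) = (e2 l f)%:E.
Proof.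
move=> Ff.
have [h _] := weighted_series_terms (fun l => max_Lnorm_ge0 _)
  (fun l => powR_gt0 (l%:R / 2) (ltr0n R 2)) (gamma2 Ff).
exact: h.
Qed.

Let sum_e1 n f : F f -> \sum_(l < n) 2 ^+ l * e1 l f <= G1.
Proof.
move=> Ff.
have [_ /(_ n)] := weighted_series_terms (fun l => sup_norm_ge0 _ z0)
  (fun l => powR_gt0 (l%:R / 1) (ltr0n R 2)) (gamma1 Ff).
apply: le_trans; apply: ler_sum => l _.
by rewrite divr1 powR_mulrn.
Qed.

Let sum_e2 n f : F f -> \sum_(l < n) Num.sqrt (2 ^+ l) * e2 l f <= G2.
Proof.
move=> Ff.
have [_ /(_ n)] := weighted_series_terms (fun l => max_Lnorm_ge0 _)
  (fun l => powR_gt0 (l%:R / 2) (ltr0n R 2)) (gamma2 Ff).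
apply: le_trans; apply: ler_sum => l _.
by rewrite powRrM powR_mulrn// powR12_sqrt// exprn_ge0.
Qed.

Let e1_ge0 l f : 0 <= e1 l f.
Proof. by rewrite fine_ge0// (sup_norm_ge0 _ z0). Qed.
Let e2_ge0 l f : 0 <= e2 l f. Proof. exact: fine_ge0. Qed.

Let cell_le l f g h z : F f -> cell (Pi1 l) f g -> cell (Pi1 l) f h ->
  `|g z - h z| <= e1 l f.
Proof.
move=> Ff fg fh; rewrite -lee_fin -e1E//.
apply: le_trans (le_diam z fg fh) _; apply: le_trans (lee_abs _) _.
by apply: ereal_sup_ubound; exists z.
Qed.

Let e1_le l f : F f -> e1 l f <= G1 / 2 ^+ l.
Proof.
move=> Ff; rewrite ler_pdivlMr ?exprn_gt0// mulrC.
apply: le_trans (sum_e1 l.+1 Ff).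
rewrite big_ord_recr/= lerDr; apply: sumr_ge0 => j _.
by rewrite mulr_ge0// exprn_ge0.
Qed.

(** [F] contains zero and forms a single cell at level 0, so the first term of the chaining sum
    already bounds the class uniformly. *)
Lemma class_le f z : F f -> `|f z| <= G1.
Proof.
move=> Ff; rewrite -[f z]subr0.
apply: le_trans (cell_le z Ff (cell_top b1 adm1 Ff Ff) (cell_top b1 adm1 Ff F0)) _.
by rewrite (le_trans (e1_le 0 Ff))// expr0 divr1.
Qed.

Section net.
Context (Lam : nat) (I : finType) (i0 : I) (g : I -> Zs -> R) (pi : nat -> I -> I).
Hypotheses (gF : forall i, F (g i)) (gi0 : g i0 = cst 0).
Hypothesis net : forall f, F f -> exists i, cell (Pi1 Lam) f (g i).
Hypotheses (pi0 : forall i, pi 0%N i = i0) (piL : forall i, pi Lam i = i).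
Hypothesis pi1 : forall l i, cell (Pi1 l) (g i) (g (pi l i)).
Hypothesis pi2 : forall l i, cell (Pi2 l) (g i) (g (pi l i)).
Hypothesis card_link : forall l, #|link pi l|%:R <= expR (4 * 2 ^+ l) :> R.

Let V := centered Z g.
Let diff c d z := g c z - g d z.
Let D c d := fine (sup_norm (EFin \o diff c d)).
Let sigma c d :=
  \big[Num.max/0]_x Num.sqrt (fine (\int[P]_w (diff c d (Z x w) ^+ 2)%:E)).

Let mg i : measurable_fun [set: Zs] (g i). Proof. exact: mF. Qed.
Let mgZ i x : measurable_fun [set: Omega] (g i \o Z x).
Proof. exact: measurableT_comp. Qed.
Let gG i z : `|g i z| <= G1. Proof. exact: class_le. Qed.

Let diff_le c d z : `|diff c d z| <= G1 + G1.
Proof. by apply: le_trans (ler_normB _ _) _; rewrite lerD. Qed.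

Let supE c d : sup_norm (EFin \o diff c d) = (D c d)%:E.
Proof.
rewrite /D fineK// ge0_fin_numE ?(sup_norm_ge0 _ z0)//.
apply: (@le_lt_trans _ _ (G1 + G1)%:E).
  by apply: ge_ereal_sup => _ [z _ <-] /=; rewrite lee_fin.
exact: ltry.
Qed.

Let D_ge0 c d : 0 <= D c d.
Proof. by rewrite fine_ge0// (sup_norm_ge0 _ z0). Qed.

Let diff_D c d z : `|diff c d z| <= D c d.
Proof. by rewrite -lee_fin -supE; apply: ereal_sup_ubound; exists z. Qed.

Let sigma_ge0 c d : 0 <= sigma c d. Proof. exact: bigmax_ge_id. Qed.

Let mdiffZ c d x : measurable_fun [set: Omega] (fun w => diff c d (Z x w)).
Proof. by apply: measurable_funB; exact: mgZ. Qed.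

Let V_diff m c d w : V m w c - V m w d = diff c d (Z (enum_val m) w)
  - fine ('E_P[(fun w => diff c d (Z (enum_val m) w))%R])%E.
Proof.
rewrite /V /centered opprD addrACA -opprD; congr (_ - _).
by rewrite (@expectationB_bounded _ _ _ _ _ _ G1)// => ?; exact: gG.
Qed.

Let pi_cells1 l i : cell (Pi1 l) (g i) (g (pi l.+1 i)).
Proof. exact: (cell_refine adm1 (pi1 _ _)). Qed.
Let pi_cells2 l i : cell (Pi2 l) (g i) (g (pi l.+1 i)).
Proof. exact: (cell_refine adm2 (pi2 _ _)). Qed.

(** [pi l.+1 i] and [pi l i] both index points of the level-[l] cell of [g i], the former by
    refinement, so their distance is at most the diameter of that cell. *)
Let sumD i : \sum_(l < Lam) 2 ^+ l * D (pi l.+1 i) (pi l i) <= G1.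
Proof.
apply: le_trans (sum_e1 Lam (gF i)); apply: ler_sum => l _.
rewrite ler_wpM2l ?exprn_ge0// -lee_fin -supE.
apply: ge_ereal_sup => _ [z _ <-] /=; rewrite lee_fin.
exact: (cell_le z (gF i)).
Qed.

Let int_diff_fin c d x :
  (\int[P]_w (diff c d (Z x w) ^+ 2)%:E)%E \is a fin_num.
Proof.
apply: integrable_fin_num => //.
apply: (@integrable_bounded _ _ _ _ _ ((G1 + G1) ^+ 2)) => [|w].
  exact: measurable_funX.
by rewrite normrX lerXn2r ?nnegrE// addr_ge0// ltW.
Qed.

Let int_diff_ge0 c d x : (0 <= \int[P]_w (diff c d (Z x w) ^+ 2)%:E)%E.
Proof. by apply: integral_ge0 => w _; rewrite lee_fin sqr_ge0. Qed.

Let sumsigma i :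
  \sum_(l < Lam) Num.sqrt (2 ^+ l) * sigma (pi l.+1 i) (pi l i) <= G2.
Proof.
apply: le_trans (sum_e2 Lam (gF i)); apply: ler_sum => l _.
rewrite ler_wpM2l ?sqrtr_ge0//; apply: bigmax_le => // x _.
rewrite -lee_fin -e2E//.
apply: (@le_trans _ _ ('N[distribution P (Z x)]_(2%:E * p)[diam (Pi2 l) (g i)])%E);
  last exact: le_bigmax.
set c := pi l.+1 i; set d := pi l i.
have <- : ((\int[distribution P (Z x)]_z (diff c d z ^+ 2)%:E) `^ 2^-1)%E =
    (Num.sqrt (fine (\int[P]_w (diff c d (Z x w) ^+ 2)%:E)))%:E.
  rewrite ge0_integral_distribution/=; last 2 first.
  - by apply/measurable_EFinP; apply: measurable_funX; exact: measurable_funB.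
  - by move=> z; rewrite lee_fin sqr_ge0.
  by rewrite poweR12_sqrt// -[in LHS](fineK (int_diff_fin c d x)).
apply: L2_norm_le => // [|z]; first exact: measurable_funB.
exact: (le_diam z).
Qed.

Let V_var m c d :
  (\int[P]_w ((V m w c - V m w d) ^+ 2)%:E <= (sigma c d ^+ 2)%:E)%E.
Proof.
under eq_integral do rewrite V_diff.
apply: le_trans (integral_sqr_center_le P (mdiffZ c d _) (fun w => diff_le c d _)) _.
rewrite -(fineK (int_diff_fin c d _)) lee_fin.
rewrite -[leLHS]sqr_sqrtr ?fine_ge0//.
rewrite lerXn2r ?nnegrE ?sqrtr_ge0//.
exact: (le_bigmax _ (fun x => Num.sqrt (fine (\int[P]_w (diff c d (Z x w) ^+ 2)%:E)))).
Qed.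

Lemma iter_avg_centered_le (s : seq 'I_#|N|) :
  (iter_avg P (centered Z g) s (max_excess i0) (fun=> 0%R)
   <= (34 * G1 + 8 * Num.sqrt (size s)%:R * G2)%:E)%E.
Proof.
have := @iter_avg_max_excess R I i0 Lam pi pi0 piL D sigma (size s)%:R G1 G2 D_ge0
  sigma_ge0 (ler0n _ _) G10 G20 sumD sumsigma (fun l _ => card_link l).
move=> /(_ _ _ P _ (centered Z g) (G1 + G1) s (measurable_centered Z mg)
  (centered_le Z mg gG)); apply => //.
- by rewrite addr_ge0// ltW.
- move=> m c d w; rewrite -/V V_diff; apply: le_trans (ler_normB _ _) _.
  rewrite mulr_natl mulr2n lerD//; apply: expectation_le_bound => //.
- move=> m c d; under eq_integral do rewrite -/V V_diff.
  exact: (integral_center P (mdiffZ c d _) (fun w => diff_le c d _)).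
Qed.

Context (K : nat) (kappa : 'I_#|N| -> 'I_K).

Let S k w i := \sum_(m <- color_class kappa k) centered Z g m w i.
Let M k w := \big[Num.max/0]_i (S k w i - S k w i0).

Let S_i0 k w : S k w i0 = 0.
Proof.
rewrite /S big1// => m _; rewrite /centered gi0 /=.
by rewrite (_ : cst 0 \o _ = cst 0)// expectation_cst subrr.
Qed.

(** Passing from [f] to its net point changes each centred term by at most [2 * eta], hence the
    whole sum by at most [G1], as [2 * #|N| <= 2 ^ Lam]. The sum is then split by colour and each
    part bounded by its own maximum. *)
Let empirical_le f w : F f -> (2 * #|N| <= 2 ^ Lam)%N ->
  empirical P Z f w <= (Num.sqrt #|N|%:R)^-1 * (\sum_k M k w + G1).
Proof.
move=> Ff NL; have [i fi] := net Ff.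
rewrite /empirical ler_wpM2l ?invr_ge0 ?sqrtr_ge0//.
pose eta := G1 / 2 ^+ Lam.
have eta0 : 0 <= eta by rewrite divr_ge0 ?exprn_ge0// ltW.
have fg z : `|f z - g i z| <= eta.
  apply: le_trans (e1_le Lam Ff); apply: cell_le => //.
  have [A [PiA Af Ag]] := fi; by exists A.
have step (x : N) : f (Z x w) - fine ('E_P[f \o Z x])%E <=
    (g i (Z x w) - fine ('E_P[g i \o Z x])%E) + 2 * eta.
  have mfZ : measurable_fun [set: Omega] (f \o Z x).
    by apply: measurableT_comp => //; exact: mF.
  have E : `|fine ('E_P[f \o Z x])%E - fine ('E_P[g i \o Z x])%E| <= eta.
    rewrite (@expectationB_bounded _ _ _ _ _ _ G1)//.
    - by apply: expectation_le_bound => [|w' /=]; [exact: measurable_funB|exact: fg].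
    - by move=> w' /=; exact: class_le.
    - by move=> w' /=; exact: gG.
  have := fg (Z x w); move: E; rewrite !ler_norml => /andP[? ?] /andP[? ?]; lra.
apply: le_trans (ler_sum _ (fun x _ => step x)) _.
rewrite big_split/= lerD//; last first.
  rewrite sumr_const -[leLHS]mulr_natr mulrAC -natrM /eta mulrCA ger_pMr//.
  by rewrite ler_pdivrMr ?exprn_gt0// mul1r -natrX ler_nat.
rewrite (reindex (@enum_val N N)) /=; last exact/onW_bij/enum_val_bij.
rewrite (partition_big kappa xpredT)//=; apply: ler_sum => k _.
have -> : \sum_(m | kappa m == k) (g i (Z (enum_val m) w)
    - fine ('E_P[g i \o Z (enum_val m)])%E) = S k w i.
  by rewrite /S /color_class big_filter big_enum_cond.
rewrite -[leLHS]subr0 -(S_i0 k w).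
exact: (le_bigmax _ (fun i => S k w i - S k w i0)).
Qed.

Lemma empirical_sup_le : (2 * #|N| <= 2 ^ Lam)%N ->
  (\int[P]_w ereal_sup [set (empirical P Z f w)%:E | f in F] <=
   ((Num.sqrt #|N|%:R)^-1)%:E *
   ((\sum_k (34 * G1 + 8 * Num.sqrt (size (color_class kappa k))%:R * G2) + G1)%:E
    + (2 * G1)%:E * \sum_k \sum_(m | kappa m == k)
        tau P (sigma_gen Z (\bigcup_(m' < #|N| | (kappa m' == k) && (m' < m)%N)
                               singletons m')%SET)
          (@dist_class R Zs (cone F) #|singletons m|) (block Z (singletons m))))%E.
Proof.
move=> NL; set tot := (\sum_k \sum_(m | _) _)%E.
have sq0 : 0 <= (Num.sqrt #|N|%:R)^-1 :> R by rewrite invr_ge0 sqrtr_ge0.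
have mM k : measurable_fun [set: Omega] (fun w => (M k w)%:E).
  have [mmax _ _ _] := max_excess_potential R i0.
  apply: (mmax _ _ (S k)) => i; apply: measurable_sum => m.
  exact: measurable_centered.
have M0 k w : (0 <= (M k w)%:E)%E by rewrite lee_fin; exact: bigmax_ge_id.
(* From here on only finite maxima, which are measurable, are integrated in place of the supremum
   over [F]. *)
apply: (@le_trans _ _ (\int[P]_w (((Num.sqrt #|N|%:R)^-1)%:E *
    (\sum_k (M k w)%:E + G1%:E)))%E).
  apply: ge0_le_integral_ub => w; first exact: sup_empirical_ge0.
  apply: ge_ereal_sup => _ [f Ff <-].
  by rewrite sumEFin -EFinD -EFinM lee_fin; exact: empirical_le.
have msum : measurable_fun [set: Omega] (fun w => \sum_k (M k w)%:E)%E.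
  exact: emeasurable_sum.
have sum0 w : (0 <= \sum_k (M k w)%:E)%E by exact: sume_ge0.
rewrite ge0_integralZl_EFin//; last 2 first.
- by move=> w _; rewrite adde_ge0// lee_fin ltW.
- exact: emeasurable_funD.
rewrite lee_wpmul2l ?lee_fin//.
rewrite ge0_integralD_cst//; last by rewrite lee_fin ltW.
rewrite [(_ + G1)%:E]EFinD [leRHS]addeAC leeD2r//.
rewrite ge0_integral_sum// -sumEFin.
rewrite /tot ge0_sume_distrr; last first.
  by move=> k _; apply: sume_ge0 => m _; rewrite /tau Lnorm_ge0.
rewrite -big_split/=; apply: lee_sum => k _.
have := color_class_decoupling Z F0 gF mg gG G10 kappa k (max_excess_potential R i0).
move=> /le_trans; apply.
rewrite leeD//; first exact: iter_avg_centered_le.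
rewrite ge0_sume_distrr// => m _; exact: Lnorm_ge0.
Qed.

End net.
End empirical_bound.

(** * Passage to the complexities, and constants *)

(* Expand [\sum_k (K sqrt (s k) - T) ^+ 2 >= 0], with [T] the left-hand side. *)
Lemma sum_sqrt_le (R : rcfType) (K n : nat) (s : 'I_K -> nat) :
  (\sum_k s k)%N = n ->
  \sum_k Num.sqrt (s k)%:R <= Num.sqrt K%:R * Num.sqrt n%:R :> R.
Proof.
move=> sn; case: K s sn => [|K] s sn.
  by rewrite big_ord0 mulr_ge0 ?sqrtr_ge0.
set T := \sum_k _.
have T0 : 0 <= T by apply: sumr_ge0 => k _; exact: sqrtr_ge0.
have : 0 <= \sum_k (K.+1%:R * Num.sqrt (s k)%:R - T) ^+ 2.
  by apply: sumr_ge0 => k _; exact: sqr_ge0.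
have -> : \sum_k (K.+1%:R * Num.sqrt (s k)%:R - T) ^+ 2 =
    K.+1%:R * (K.+1%:R * n%:R - T ^+ 2).
  under eq_bigr => k _.
    rewrite (_ : _ ^+ 2 = K.+1%:R ^+ 2 * (s k)%:R + (T ^+ 2 -
        2 * K.+1%:R * T * Num.sqrt (s k)%:R)); last first.
      by rewrite -[X in _ = _ * X + _]sqr_sqrtr//; ring.
    over.
  rewrite !big_split/= -mulr_sumr -natr_sum sn sumr_const card_ord sumrN -mulr_sumr.
  by rewrite -/T -mulr_natr; ring.
rewrite pmulr_rge0 ?ltr0n// subr_ge0 -sqrtrM// => TKn.
by rewrite -[T]ger0_norm// -sqrtr_sqr ler_wsqrtr.
Qed.

Lemma gamma_ge0 (R : realType) (q s : R) (T : Type) (F : set (T -> R))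
    (d : (T -> \bar R) -> \bar R) : F !=set0 -> (forall h, 0 <= d h)%E ->
  (0 <= gamma q s F d)%E.
Proof.
move=> [f Ff] d0; apply: le_ereal_inf_tmp => _ [Pi _ <-].
apply: (@le_trans _ _ (\sum_(0 <= l <oo) (2 `^ (l%:R / q))%:E * d (diam (Pi l) f))%E).
  by apply: nneseries_ge0 => l _ _; rewrite mule_ge0// lee_fin powR_ge0.
by apply: ereal_sup_ubound; exists f.
Qed.

Lemma gamma_lt (R : realType) (q s G : R) (T : Type) (F : set (T -> R))
    (d : (T -> \bar R) -> \bar R) : (gamma q s F d < G%:E)%E ->
  exists2 Pi, admissible s F Pi & forall f, F f ->
    (\sum_(0 <= l <oo) (2 `^ (l%:R / q))%:E * d (diam (Pi l) f) <= G%:E)%E.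
Proof.
move=> /ereal_inf_lt[_ [Pi adm <-] lt]; exists Pi => // f Ff.
by apply: le_trans (ltW lt); apply: ereal_sup_ubound; exists f.
Qed.

(** [sq] is the square root of n, [x] and [y] are the two complexities, [t] is the mean [tau]
    coefficient and [E1] is exp(cr/2); [2 * x] and [y + x / sq] are the chaining bounds. The
    multiples of [C0 * E1 ^+ 2 * x] add up to 68 + 8 + 2 = 78. *)
Lemma assemble_constants (R : realFieldType) (C0 E1 sq x y t K T : R) :
  1 <= C0 -> 1 <= E1 -> 0 < sq -> 0 < x -> 0 <= y -> 0 <= t ->
  K <= C0 * E1 ^+ 2 -> T <= C0 * E1 * sq ->
  sq^-1 * (34 * (2 * x) * K + 8 * T * (y + x / sq) + 2 * x
    + 2 * (2 * x) * (sq ^+ 2 * t)) <=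
  78 * C0 * (E1 * y + (E1 ^+ 2 / sq + sq * t) * x).
Proof.
move=> C01 E11 sq0 x0 y0 t0 KC TE.
have C00 : 0 <= C0 by rewrite (le_trans _ C01).
have E10 : 0 <= E1 by rewrite (le_trans _ E11).
have E12 : E1 <= E1 ^+ 2 by rewrite expr2 ler_peMl.
have C0E2 : 1 <= C0 * E1 ^+ 2 by rewrite -[1]mulr1 ler_pM// (le_trans E11).
have sqN0 : sq != 0 by rewrite gt_eqF.
rewrite mulrC ler_pdivrMr//.
have h1 : 34 * (2 * x) * K <= 34 * (2 * x) * (C0 * E1 ^+ 2).
  by rewrite ler_wpM2l// !mulr_ge0// ltW.
have h2 : 8 * T * (y + x / sq) <= 8 * (C0 * E1 * sq) * (y + x / sq).
  by rewrite ler_wpM2r ?ler_wpM2l// addr_ge0// divr_ge0// ltW.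
have h3 : 8 * (C0 * E1 * sq) * (y + x / sq) =
    8 * (C0 * E1 * sq * y) + 8 * (C0 * E1 * x) by field.
have h4 : C0 * E1 * x <= C0 * E1 ^+ 2 * x.
  by rewrite ler_wpM2r ?(ltW x0)// ler_wpM2l.
have h5 : x <= C0 * E1 ^+ 2 * x by rewrite ler_peMl// ltW.
have h6 : 78 * C0 * (E1 * y + (E1 ^+ 2 / sq + sq * t) * x) * sq =
    78 * (C0 * E1 * sq * y) + 78 * (C0 * E1 ^+ 2 * x)
    + 78 * (C0 * (sq ^+ 2 * t * x)) by field.
have h8 : 0 <= sq ^+ 2 * t * x by rewrite !mulr_ge0// ltW.
have h7 : sq ^+ 2 * t * x <= C0 * (sq ^+ 2 * t * x) by rewrite ler_peMl.
have h9 : 0 <= C0 * E1 * sq * y by rewrite !mulr_ge0// ltW.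
rewrite h6; lra.
Qed.

Section assembly.
Context dO (Omega : measurableType dO) (R : realType) (P : probability Omega R).
Context dZ (Zs : measurableType dZ) (N : finType) (Z : N -> {RV P >-> Zs}).
Context (F : set (Zs -> R)) (a b : R) (p : \bar R) (z0 : Zs).
Hypotheses (F0 : F (cst 0)).
Hypotheses (mF : forall f, F f -> measurable_fun [set: Zs] f).
Hypotheses (a1 : 1 <= a) (b1 : 1 <= b) (p1 : (1 <= p)%E) (N0 : (0 < #|N|)%N).
Context (K : nat) (kappa : 'I_#|N| -> 'I_K) (C0 E1 : R).
Hypotheses (C01 : 1 <= C0) (E11 : 1 <= E1) (KC : K%:R <= C0 * E1 ^+ 2).

Let n : R := #|N|%:R.
Let sup_emp w := ereal_sup [set (empirical P Z f w)%:E | f in F].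
Let g1 := gamma 1 b F (@sup_norm R Zs).
Let g2 := gamma 2 a F (max_Lnorm Z (2%:E * p)).
Let tb := tau_bar P Z (cone F) (@singletons N) kappa.

Let n0 : 0 < n. Proof. by rewrite ltr0n. Qed.
Let sn0 : 0 < Num.sqrt n. Proof. by rewrite sqrtr_gt0. Qed.

Let g1_ge0 : (0 <= g1)%E.
Proof. by apply: gamma_ge0 => [|h]; [exists (cst 0)|exact: sup_norm_ge0 z0]. Qed.

Let g2_ge0 : (0 <= g2)%E.
Proof. by apply: gamma_ge0 => [|h]; [exists (cst 0)|exact: bigmax_ge_id]. Qed.

Let tb_ge0 : (0 <= tb)%E.
Proof.
rewrite /tb /tau_bar mule_ge0 ?lee_fin//.
by apply: sume_ge0 => k _; apply: sume_ge0 => m _; exact: Lnorm_ge0.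
Qed.

Let rhs : \bar R := ((78 * C0)%:E * (E1%:E * g2 +
  ((E1 ^+ 2 / Num.sqrt n)%:E + (Num.sqrt n)%:E * tb) * g1))%E.

Let rhs_coef_gt0 : (0 < (E1 ^+ 2 / Num.sqrt n)%:E + (Num.sqrt n)%:E * tb)%E.
Proof.
apply: (@lt_le_trans _ _ (E1 ^+ 2 / Num.sqrt n)%:E).
  by rewrite lte_fin divr_gt0// exprn_gt0// (lt_le_trans ltr01).
by rewrite leeDl// mule_ge0// lee_fin ltW.
Qed.

(** Chaining needs [G1 > 0]. When [g1] vanishes, [class_le] holds with arbitrarily small bounds, so
    every function of [F] is zero, and so is the process. *)
Let degenerate : g1 = 0%E -> (\int[P]_w sup_emp w <= rhs)%E.
Proof.
move=> g10; suff emp0 w : (sup_emp w <= 0)%E.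
  apply: (@le_trans _ _ (\int[P]_w 0)%E).
    by apply: ge0_le_integral_ub => // w; exact: sup_empirical_ge0.
  rewrite integral0 /rhs g10 mule0 adde0 mule_ge0// ?lee_fin ?mule_ge0 ?lee_fin//.
    by rewrite mulr_ge0// (le_trans _ C01).
  by rewrite (le_trans _ E11).
have F00 f z : F f -> f z = 0.
  move=> Ff; apply/eqP; rewrite -normr_le0; apply/ler_addgt0Pr => e e0.
  rewrite add0r; have : (g1 < e%:E)%E by rewrite g10 lte_fin.
  move=> /gamma_lt[Pi adm PiG].
  exact: (class_le F0 b1 adm z0 PiG z Ff).
apply: ge_ereal_sup => _ [f Ff <-]; rewrite lee_fin /empirical big1 ?mulr0// => x _.
rewrite (_ : f \o Z x = cst 0); last by apply/funext => w' /=; exact: F00.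
by rewrite expectation_cst F00// subrr.
Qed.

Lemma empirical_sup_le_gamma : (\int[P]_w sup_emp w <= rhs)%E.
Proof.
have C0_gt0 : 0 < 78 * C0 by rewrite mulr_gt0// (lt_le_trans ltr01).
have E1_gt0 : 0 < E1 by rewrite (lt_le_trans ltr01).
have coef_g1_ge0 : (0 <= ((E1 ^+ 2 / Num.sqrt n)%:E + (Num.sqrt n)%:E * tb) * g1)%E.
  by rewrite mule_ge0// ltW.
have coef_g2_ge0 : (0 <= E1%:E * g2)%E by rewrite mule_ge0// lee_fin ltW.
have [g10|g1N0] := eqVneq g1 0%E; first exact: degenerate.
(* If one of the three quantities is infinite, so is the right-hand side; for [tb] this uses [g1]
   nonzero, since the product of [+oo] and 0 is 0. *)
have [g1y|g1Ny] := eqVneq g1 +oo%E.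
  suff -> : rhs = +oo%E by rewrite leey.
  rewrite /rhs g1y gt0_muley// addey ?gt0_muley ?lte_fin//.
  by rewrite gt_eqF// (lt_le_trans (ltNyr 0)).
have [g2y|g2Ny] := eqVneq g2 +oo%E.
  suff -> : rhs = +oo%E by rewrite leey.
  rewrite /rhs g2y [(E1%:E * _)%E]gt0_muley ?lte_fin// addye ?gt0_muley ?lte_fin//.
  by rewrite gt_eqF// (lt_le_trans (ltNyr 0)).
have [tby|tbNy] := eqVneq tb +oo%E.
  suff -> : rhs = +oo%E by rewrite leey.
  rewrite /rhs tby gt0_muley ?lte_fin// addey// gt0_mulye ?lt0e ?g1N0//.
  rewrite addey ?gt0_muley ?lte_fin//.
  by rewrite gt_eqF// (lt_le_trans (ltNyr 0)).
have g1E : g1 = (fine g1)%:E by rewrite fineK// ge0_fin_numE// ltey.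
have g2E : g2 = (fine g2)%:E by rewrite fineK// ge0_fin_numE// ltey.
have tbE : tb = (fine tb)%:E by rewrite fineK// ge0_fin_numE// ltey.
move: (fine g1) (fine g2) (fine tb) g1E g2E tbE => x y t g1E g2E tbE.
have x0 : 0 < x by rewrite -lte_fin -g1E lt0e g1N0.
have y0 : 0 <= y by rewrite -lee_fin -g2E.
have t0 : 0 <= t by rewrite -lee_fin -tbE.
(* The excess of [G2] over [y] also works when [y = 0], and costs only
   [x / sqrt n]. *)
pose G1 := 2 * x; pose G2 := y + x / Num.sqrt n.
have G10 : 0 < G1 by rewrite mulr_gt0.
have G20 : 0 <= G2 by rewrite addr_ge0// divr_ge0// ltW.
have : (g1 < G1%:E)%E by rewrite g1E lte_fin /G1; lra.
move=> /gamma_lt[Pi1 adm1 Pi1G].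
have : (g2 < G2%:E)%E by rewrite g2E lte_fin /G2 ltrDl divr_gt0.
move=> /gamma_lt[Pi2 adm2 Pi2G].
(* The chain has [2 * #|N|] levels, enough for the approximation error since m <= 2^m; its length
   does not enter the bounds. *)
have L0 : (0 < 2 * #|N|)%N by rewrite muln_gt0.
have [I [i0 [g [pi [[gF gi0] net [pi0 piL] pic card_link]]]]] :=
  chaining_net a1 b1 L0 F0 adm1 adm2.
have NL : (2 * #|N| <= 2 ^ (2 * #|N|))%N by rewrite ltnW// ltn_expl.
have := empirical_sup_le F0 mF b1 p1 adm1 adm2 G10 G20 z0 Pi1G Pi2G gF gi0 net pi0 piL
  (fun l i => (pic l i).1) (fun l i => (pic l i).2) card_link kappa NL.
move=> /le_trans; apply; set tot := (\sum_k \sum_(m | _) _)%E.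
have totE : tot = (n * t)%:E.
  have : tb = ((n^-1)%:E * tot)%E by [].
  by rewrite tbE EFinM => ->; rewrite muleA -EFinM divff ?mul1e// gt_eqF.
rewrite totE /rhs g1E g2E tbE; do ?[rewrite -EFinM|rewrite -EFinD].
rewrite lee_fin -/n.
rewrite big_split/= sumr_const card_ord -mulr_suml -mulr_sumr -[34 * G1 *+ K]mulr_natr.
set T := \sum_k _.
have sizes : (\sum_k size (color_class kappa k) = #|N|)%N.
  under eq_bigr => k _ do rewrite /color_class size_filter -sum1_count big_enum_cond/=.
  transitivity (\sum_(m < #|N|) 1)%N; last by rewrite sum1_card card_ord.
  by rewrite [RHS](partition_big kappa xpredT).
(* Cauchy-Schwarz over the colour classes, with [K <= C0 * E1 ^+ 2 <= (C0 * E1) ^+ 2]. *)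
have TE : T <= C0 * E1 * Num.sqrt n.
  apply: le_trans (sum_sqrt_le _ sizes) _; rewrite ler_wpM2r ?sqrtr_ge0//.
  apply: (@le_trans _ _ (Num.sqrt ((C0 * E1) ^+ 2))).
    rewrite ler_wsqrtr// (le_trans KC)// exprMn ler_wpM2r ?exprn_ge0 ?(ltW E1_gt0)//.
    by rewrite expr2 ler_peMl// (le_trans _ C01).
  by rewrite sqrtr_sqr ger0_norm// mulr_ge0 ?(ltW E1_gt0)// (le_trans _ C01).
have nE : n = Num.sqrt n ^+ 2 by rewrite sqr_sqrtr// ltW.
by rewrite [X in _ + _ * (X * t)]nE; exact: assemble_constants.
Qed.

End assembly.
Theorem proposition2 (R : realType) (C c : R) (C_gt0 : 0 < C) (c_gt0 : 0 < c) :
  exists2 K : R, 0 < K &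
  forall (N : nat -> finType) (e : forall n, rel (N n)),
    (forall n, #|N n| = n) ->
    (forall n, symmetric (e n)) ->
    exp_shell_growth C c e ->
  exists2 q : nat -> R, (forall n, K^-1 <= q n <= K) &
  forall (dO : measure_display) (Omega : measurableType dO)
    (P : probability Omega R) (S : ptopologicalType)
    (Z : forall n, N n -> {RV P >-> borel S}) (F : set (borel S -> R)),
    polish_space R S ->
    (forall n (A B : {set N n}), A :&: B = finset.set0 ->
      gdist_set R (e n) A B = +oo%E ->
      independent_fields P (sigma_gen (@Z n) A) (sigma_gen (@Z n) B)) ->
    F (cst 0) ->
    (forall f, F f -> measurable_fun [set: borel S] f) ->
  forall (n : nat) (a b : R) (p : \bar R) (r : nat),
    (0 < n)%N -> 1 <= a -> 1 <= b -> (1%:E <= p)%E ->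
  exists (M : nat) (B : 'I_M -> {set N n}),
    [/\ partition_family B,
        (forall m, #|B m|%:R <= K * q n) &
        forall kappa : 'I_M -> 'I_(chromatic R (e n) r B),
          proper_coloring R (e n) r B (fun m => kappa m) ->
        ('N[P]_1%:E[(fun w => ereal_sup [set (empirical P (@Z n) f w)%:E | f in F])]
         <= K%:E *
            ((expR (c * r%:R / 2))%:E *
               gamma 2 a F (max_Lnorm (@Z n) (2%:E * p))
             + ((expR (c * r%:R) / Num.sqrt n%:R)%:E
                + (Num.sqrt n%:R)%:E * tau_bar P (@Z n) (cone F) B kappa)
               * gamma 1 b F (@sup_norm R (borel S))))%E].
Proof.
pose C0 := 1 + C * (1 - expR (- c))^-1.
have C01 : 1 <= C0.
  rewrite lerDl mulr_ge0// ltW// ?invr_gt0 ?subr_gt0 ?expR_lt1 ?oppr_lt0//.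
have K0 : 1 <= 78 * C0 by lra.
exists (78 * C0); first by lra.
(* The blocks are singletons, so the size bound [q] is constantly 1. *)
move=> N e cardN se growth; exists (fun=> 1) => [n|].
  by rewrite K0 andbT invf_le1// (lt_le_trans ltr01).
move=> dO Omega P S Z F _ _ F0 mF n a b p r n0 a1 b1 p1.
exists #|N n|, (@singletons (N n)); split.
- exact: singletons_partition.
- by move=> m; rewrite cards1 mulr1.
move=> kappa _.
have N0 : (0 < #|N n|)%N by rewrite cardN.
have expE : expR (c * r%:R / 2) ^+ 2 = expR (c * r%:R).
  by rewrite -expRM_natl; congr expR; field.
(* With [E1 = expR (c * r%:R / 2)], the number of colours has order [E1 ^+ 2], and only its square
   root multiplies the [gamma 2] term. *)
have KC : (chromatic R (e n) r (@singletons (N n)))%:R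
    <= C0 * expR (c * r%:R / 2) ^+ 2.
  apply: le_trans (chromatic_singletons _ C_gt0 c_gt0 (se n) (growth n)) _.
  by rewrite expE.
have E11 : 1 <= expR (c * r%:R / 2).
  by rewrite -[leLHS]expR0 ler_expR !mulr_ge0// ltW.
have := @empirical_sup_le_gamma _ _ _ P _ _ _ (@Z n) F a b p point F0 mF a1 b1 p1
  N0 _ kappa _ _ C01 E11 KC.
rewrite expE.
have -> : #|N n|%:R = n%:R :> R by rewrite cardN.
apply: le_trans; rewrite Lnorm1.
rewrite le_eqVlt; apply/orP; left; apply/eqP; apply: eq_integral => w _.
by rewrite gee0_abs// sup_empirical_ge0.
Qed.
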